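(* Let $y:M\to Q^4_1$ be a spacelike isothermic surface with adapted coordinate $z$, let $\theta$ be a non-zero real constant, and let $y^{\ast}:M\to Q^4_1$ be a $D^\theta$-transform of $y$ (with respect to $z$). Let $[L]$ and $[L^{\ast}]$ be the left polar surfaces of $y$ and $y^{\ast}$ respectively. If both $[L]$ and $[L^{\ast}]$ are non-degenerate, then $[L^{\ast}]$ is a $D^\theta$-transform of $[L]$ (with respect to the same coordinate $z$ and with the same $\theta$). Likewise, if the right polar surfaces $[R]$ of $y$ and $[R^{\ast}]$ of $y^{\ast}$ are both non-degenerate, then $[R^{\ast}]$ is a $D^\theta$-transform of $[R]$.
   Context: $\mathbb{R}^6_2$ is $\mathbb{R}^6$ with the quadratic form $\langle x,x\rangle=\sum_{i=1}^4x_i^2-x_5^2-x_6^2$ (extended complex-bilinearly to $\mathbb{C}^6$) and a fixed orientation; $C^5$ is its light cone, and $Q^4_1=\{[x]\in\mathbb{R}P^5: x\in C^5\setminus\{0\}\}$, with projection $\pi:C^5\setminus\{0\}\to Q^4_1$. All maps are smooth. A local lift of $y:M\to Q^4_1$ on an open set $U$ is a map $Y:U\to C^5\setminus\{0\}$ with $\pi\circ Y=y$; we write $y=[Y]$. Conformal spacelike surface: an immersion $y:M\to Q^4_1$ of a Riemann surface $M$ such that $\langle Y_z,Y_z\rangle=0$ and $\langle Y_z,Y_{\bar z}\rangle>0$ for any local lift $Y$ and any complex coordinate $z$. Then $M\times\mathbb{R}^6_2=V\oplus V^\perp$, where $V=\mathrm{Span}\{Y,\mathrm{Re}(Y_z),\mathrm{Im}(Y_z),Y_{z\bar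 z}\}$ is a Lorentzian rank-4 bundle, independent of the choice of $Y$ and $z$, and $V^\perp$ is a Lorentzian rank-2 bundle (the normal bundle). Canonical lift with respect to a complex coordinate $z=u+\mathrm{i}v$: the local lift $Y$ (unique up to sign) with $|\mathrm{d}Y|^2=|\mathrm{d}z|^2$. With $Y$ canonical, $N\in\Gamma(V)$ is determined by $\langle N,Y_z\rangle=\langle N,Y_{\bar z}\rangle=\langle N,N\rangle=0$, $\langle N,Y\rangle=-1$. One has $Y_{zz}=-\frac{s}{2}Y+\kappa$ with a complex function $s$ and a section $\kappa$ of $V^\perp\otimes\mathbb{C}$ (the conformal Hopf differential). A point is umbilic if $\kappa=0$ there. Isothermic: a conformal spacelike surface $y$ without umbilic points is called isothermic if around each point of $M$ there is a complex coordinate $z$ such that, for the canonical lift with respect to $z$, $\kappa$ is real-valued (i.e. $\kappa=\bar\kappa$). Such a $z$ is called an adapted coordinate. Here a single adapted coordinate $z$ is fixed and $M$ is its domain. Polar surfaces: for a conformal spacelike surface, locally choose a frame $\{L,R\}$ of $V^\perp$ with $\langle L,L\rangle=\langle R,R\rangle=0$, $\langle L,R\rangle=-1$ and such that $\{Y,Y_u,Y_v,N,R,L\}$ is positively oriented in $\mathbb{R}^6_2$. The null lines $[L]$ and $[R]$ are then well defined, and the maps $[L],[R]:M\to Q^4_1$ are called the left and the right polar surface of $y=[Y]$. A polar surface is called non-degenerate if it is an immersion; writing $\kappa=\lambda_1L+\lambda_2R$, $[L]$ is degenerate exactly where $\lambda_2=0$ and $[R]$ exactly where $\lambda_1=0$.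 Known fact used for the claim to make sense: non-degenerate polar surfaces of a spacelike isothermic surface are spacelike isothermic with the same adapted coordinate. $D^\theta$-transform: let $y=[Y]$ be spacelike isothermic with canonical lift $Y$ with respect to the adapted coordinate $z$. A spacelike immersion $y^{\ast}:M\to Q^4_1$ is a Darboux transform of $y$ if its local lifts $Y^{\ast}$ (not necessarily canonical) satisfy $Y^{\ast}_z\in\mathrm{Span}_{\mathbb{C}}\{Y^{\ast},Y,Y_{\bar z}\}$. It is called a $D^\theta$-transform of $y$, for a non-zero real constant $\theta$, if for the local lift $Y^{\ast}$ normalized by $\langle Y,Y^{\ast}\rangle=-1$ one has $$Y^{\ast}_z=\frac{\mu}{2}Y^{\ast}+\theta\Big(Y_{\bar z}+\frac{\bar\mu}{2}Y\Big)$$ for some complex-valued function $\mu$. (Such a $y^{\ast}$ is automatically a conformal spacelike surface.) *)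

(* Defs.v *)
From HB Require Import structures.
From mathcomp Require Import all_boot all_order all_algebra.
From mathcomp Require Import complex.
From mathcomp Require Import all_classical all_reals all_analysis.

Set Implicit Arguments.
Unset Strict Implicit.
Unset Printing Implicit Defensive.

Import Order.TTheory GRing.Theory Num.Theory.
Import numFieldNormedType.Exports.

Local Open Scope classical_set_scope.
Local Open Scope ring_scope.
Local Open Scope complex_scope.

(* The points of the coordinate domain: (u, v) stands for z = u + i v. *)
Notation plane R := (R * R)%type.

(* The form of signature (4,2), over any commutative ring: used over R and,
   as the complex-bilinear extension, over R[i]. *)
Definition form42 (T : comNzRingType) (x y : 'rV[T]_6) : T :=
  \sum_(i < 6) (-1) ^+ (4 <= i)%N * (x 0 i * y 0 i).

Definition cplx (R : realType) (x : 'rV[R]_6) : 'rV[R[i]]_6 :=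
  map_mx (fun a => a%:C) x.
Definition reV (R : realType) (x : 'rV[R[i]]_6) : 'rV[R]_6 :=
  map_mx (@complex.Re R) x.
Definition imV (R : realType) (x : 'rV[R[i]]_6) : 'rV[R]_6 :=
  map_mx (@complex.Im R) x.
Definition conjV (R : realType) (x : 'rV[R[i]]_6) : 'rV[R[i]]_6 :=
  map_mx (fun a => a^*%C) x.

Definition light_cone (R : realType) : set 'rV[R]_6 := [set x | form42 x x = 0].

(* Points of RP^5 are the lines of R^6. *)
Definition qproj (R : realType) (x : 'rV[R]_6) : {vspace 'rV[R]_6} := <[x]>%VS.

Definition Q41 (R : realType) : set {vspace 'rV[R]_6} :=
  [set @qproj R x | x in light_cone (R := R) `\ 0].

Definition pu (R : realType) (W : normedModType R) (f : plane R -> W) :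
  plane R -> W := 'D_((1, 0) : plane R) f.
Definition pv (R : realType) (W : normedModType R) (f : plane R -> W) :
  plane R -> W := 'D_((0, 1) : plane R) f.

Fixpoint Ck (R : realType) (W : normedModType R) (k : nat) (U : set (plane R))
    (f : plane R -> W) : Prop :=
  (forall p, U p -> {for p, continuous f}) /\
  match k with
  | 0 => True
  | k'.+1 =>
      [/\ forall p, U p -> derivable f p (1, 0) /\ derivable f p (0, 1),
          Ck k' U (pu f) & Ck k' U (pv f)]
  end.

Definition smooth_on (R : realType) (W : normedModType R) (U : set (plane R))
  (f : plane R -> W) : Prop := forall k, Ck k U f.

Definition smoothC (R : realType) (U : set (plane R)) (m : plane R -> R[i]) :
    Prop :=
  smooth_on U (fun p => complex.Re (m p)) /\
  smooth_on U (fun p => complex.Im (m p)).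
Definition smoothCV (R : realType) (U : set (plane R))
    (G : plane R -> 'rV[R[i]]_6) : Prop :=
  smooth_on U (fun p => reV (G p)) /\ smooth_on U (fun p => imV (G p)).

Definition puC (R : realType) (G : plane R -> 'rV[R[i]]_6) (p : plane R) :
    'rV[R[i]]_6 :=
  cplx (pu (fun q => reV (G q)) p) + 'i%C *: cplx (pu (fun q => imV (G q)) p).
Definition pvC (R : realType) (G : plane R -> 'rV[R[i]]_6) (p : plane R) :
    'rV[R[i]]_6 :=
  cplx (pv (fun q => reV (G q)) p) + 'i%C *: cplx (pv (fun q => imV (G q)) p).

(* The Wirtinger operators d/dz and d/dzbar. *)
Definition dz (R : realType) (G : plane R -> 'rV[R[i]]_6) (p : plane R) :
  'rV[R[i]]_6 := 2^-1 *: (puC G p - 'i%C *: pvC G p).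
Definition dzb (R : realType) (G : plane R -> 'rV[R[i]]_6) (p : plane R) :
  'rV[R[i]]_6 := 2^-1 *: (puC G p + 'i%C *: pvC G p).

Definition cplxf (R : realType) (Y : plane R -> 'rV[R]_6) (p : plane R) :
  'rV[R[i]]_6 := cplx (Y p).

Definition Yz (R : realType) (Y : plane R -> 'rV[R]_6) := dz (cplxf Y).
Definition Yzb (R : realType) (Y : plane R -> 'rV[R]_6) := dzb (cplxf Y).
Definition Yzz (R : realType) (Y : plane R -> 'rV[R]_6) := dz (Yz Y).
Definition Yzzb (R : realType) (Y : plane R -> 'rV[R]_6) := dzb (Yz Y).

(* The differential dY_p, applied to the tangent vector w. *)
Definition dmap (R : realType) (Y : plane R -> 'rV[R]_6) (p w : plane R) :
  'rV[R]_6 := w.1 *: pu Y p + w.2 *: pv Y p.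

Definition local_lift (R : realType) (U : set (plane R))
    (y : plane R -> {vspace 'rV[R]_6}) (Y : plane R -> 'rV[R]_6) : Prop :=
  smooth_on U Y /\
  forall p, U p -> [/\ Y p <> 0, light_cone (Y p) & qproj (Y p) = y p].

(* A map into Q^4_1 is smooth iff it has smooth lifts around each point. *)
Definition smooth_map (R : realType) (M : set (plane R))
    (y : plane R -> {vspace 'rV[R]_6}) : Prop :=
  (forall p, M p -> Q41 (y p)) /\
  forall p, M p -> exists (U : set (plane R)) (Y : plane R -> 'rV[R]_6),
    [/\ open U, U p, U `<=` M & local_lift U y Y].

(* The kernel of the differential of qproj at x is the line of x, so that
   d(qproj \o Y)_p is injective iff dY_p(w) in <[Y p]> forces w = 0. *)
Definition immersion (R : realType) (M : set (plane R))
    (y : plane R -> {vspace 'rV[R]_6}) : Prop :=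
  smooth_map M y /\
  forall (U : set (plane R)) (Y : plane R -> 'rV[R]_6),
    open U -> U `<=` M -> local_lift U y Y ->
    forall p w, U p -> dmap Y p w \in qproj (Y p) -> w = 0.

Definition spacelike_immersion (R : realType) (M : set (plane R))
    (y : plane R -> {vspace 'rV[R]_6}) : Prop :=
  immersion M y /\
  forall (U : set (plane R)) (Y : plane R -> 'rV[R]_6),
    open U -> U `<=` M -> local_lift U y Y ->
    forall p w, U p -> w <> 0 -> 0 < form42 (dmap Y p w) (dmap Y p w).

(* In R[i], 0 < a means that a is real and positive. *)
Definition conformal_spacelike (R : realType) (M : set (plane R))
    (y : plane R -> {vspace 'rV[R]_6}) : Prop :=
  immersion M y /\
  forall (U : set (plane R)) (Y : plane R -> 'rV[R]_6),
    open U -> U `<=` M -> local_lift U y Y ->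
    forall p, U p ->
      form42 (Yz Y p) (Yz Y p) = 0 /\ 0 < form42 (Yz Y p) (Yzb Y p).

(* |dY|^2 = |dz|^2 *)
Definition canonical_lift (R : realType) (U : set (plane R))
    (y : plane R -> {vspace 'rV[R]_6}) (Y : plane R -> 'rV[R]_6) : Prop :=
  local_lift U y Y /\
  forall p w, U p -> form42 (dmap Y p w) (dmap Y p w) = w.1 ^+ 2 + w.2 ^+ 2.

(* The fibre of V at p. As Y is real, Y_{z zbar} is real up to the symmetry of
   second derivatives, and is represented here by its real part. *)
Definition Vbundle (R : realType) (Y : plane R -> 'rV[R]_6) (p : plane R) :
  {vspace 'rV[R]_6} :=
  <<[:: Y p; reV (Yz Y p); imV (Yz Y p); reV (Yzzb Y p)]>>%VS.

Definition normal_vec (R : realType) (Y : plane R -> 'rV[R]_6) (p : plane R)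
    (x : 'rV[R]_6) : Prop :=
  forall w, w \in Vbundle Y p -> form42 x w = 0.

Definition normal_vecC (R : realType) (Y : plane R -> 'rV[R]_6) (p : plane R)
    (x : 'rV[R[i]]_6) : Prop :=
  forall w, w \in Vbundle Y p -> form42 x (cplx w) = 0.

Definition N_section (R : realType) (U : set (plane R))
    (Y N : plane R -> 'rV[R]_6) : Prop :=
  smooth_on U N /\
  forall p, U p ->
    N p \in Vbundle Y p /\
    [/\ form42 (cplx (N p)) (Yz Y p) = 0, form42 (cplx (N p)) (Yzb Y p) = 0,
        form42 (N p) (N p) = 0 & form42 (N p) (Y p) = -1].

Definition hopf_differential (R : realType) (U : set (plane R))
    (Y : plane R -> 'rV[R]_6) (s : plane R -> R[i])
    (kappa : plane R -> 'rV[R[i]]_6) : Prop :=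
  [/\ smoothC U s, smoothCV U kappa
    & forall p, U p ->
        Yzz Y p = - (s p / 2) *: cplx (Y p) + kappa p /\
        normal_vecC Y p (kappa p)].

(* Spacelike isothermic (without umbilics), with the coordinate z = u + i v
   of the plane as an adapted coordinate on all of M. *)
Definition isothermic (R : realType) (M : set (plane R))
    (y : plane R -> {vspace 'rV[R]_6}) : Prop :=
  conformal_spacelike M y /\
  forall (U : set (plane R)) (Y : plane R -> 'rV[R]_6),
    open U -> U `<=` M -> canonical_lift U y Y ->
    exists (s : plane R -> R[i]) (kappa : plane R -> 'rV[R[i]]_6),
      hopf_differential U Y s kappa /\
      forall p, U p -> kappa p <> 0 /\ conjV (kappa p) = kappa p.

(* The orientation of R^6_2 is the standard one of R^6. *)
Definition pos_oriented (R : realType) (a b c d e f : 'rV[R]_6) : Prop :=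
  0 < \det (\matrix_(i < 6) nth 0 [:: a; b; c; d; e; f] i).

Definition null_frame (R : realType) (U : set (plane R))
    (y : plane R -> {vspace 'rV[R]_6})
    (Y L Rt : plane R -> 'rV[R]_6) : Prop :=
  [/\ canonical_lift U y Y, smooth_on U L, smooth_on U Rt
    & exists N : plane R -> 'rV[R]_6,
        N_section U Y N /\
        forall p, U p ->
          [/\ normal_vec Y p (L p), normal_vec Y p (Rt p),
              form42 (L p) (L p) = 0 /\ form42 (Rt p) (Rt p) = 0,
              form42 (L p) (Rt p) = -1
            & pos_oriented (Y p) (pu Y p) (pv Y p) (N p) (Rt p) (L p)]].

Definition left_polar (R : realType) (M : set (plane R))
    (y l : plane R -> {vspace 'rV[R]_6}) : Prop :=
  forall p, M p ->
    exists (U : set (plane R)) (Y L Rt : plane R -> 'rV[R]_6),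
      [/\ open U, U p, U `<=` M, null_frame U y Y L Rt
        & forall q, U q -> l q = qproj (L q)].

Definition right_polar (R : realType) (M : set (plane R))
    (y r : plane R -> {vspace 'rV[R]_6}) : Prop :=
  forall p, M p ->
    exists (U : set (plane R)) (Y L Rt : plane R -> 'rV[R]_6),
      [/\ open U, U p, U `<=` M, null_frame U y Y L Rt
        & forall q, U q -> r q = qproj (Rt q)].

Definition nondegenerate_polar (R : realType) (M : set (plane R))
  (y : plane R -> {vspace 'rV[R]_6}) : Prop := immersion M y.

Definition darboux_transform (R : realType) (M : set (plane R))
    (y ys : plane R -> {vspace 'rV[R]_6}) : Prop :=
  [/\ isothermic M y, spacelike_immersion M ys
    & forall (U : set (plane R)) (Y Ys : plane R -> 'rV[R]_6),
        open U -> U `<=` M -> canonical_lift U y Y -> local_lift U ys Ys ->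
        forall p, U p ->
          Yz Ys p \in <<[:: cplx (Ys p); cplx (Y p); Yzb Y p]>>%VS].

(* The normalized lift Ys is required to exist over the whole domain of every
   canonical lift Y: ys is nowhere orthogonal to y. It is then unique. *)
Definition Dtheta_transform (R : realType) (M : set (plane R)) (theta : R)
    (y ys : plane R -> {vspace 'rV[R]_6}) : Prop :=
  darboux_transform M y ys /\
  forall (U : set (plane R)) (Y : plane R -> 'rV[R]_6),
    open U -> U `<=` M -> canonical_lift U y Y ->
    exists Ys : plane R -> 'rV[R]_6,
      [/\ local_lift U ys Ys,
          forall p, U p -> form42 (Y p) (Ys p) = -1
        & exists mu : plane R -> R[i],
            smoothC U mu /\
            forall p, U p ->
              Yz Ys p = (mu p / 2) *: cplx (Ys p) +
                theta%:C *: (Yzb Y p + ((mu p)^*%C / 2) *: cplx (Y p))].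

(* Main.v *)
Require Import Defs.
From mathcomp Require Import all_boot all_order all_algebra.
From mathcomp Require Import complex.
From mathcomp Require Import all_classical all_reals all_analysis.
From mathcomp Require Import perm ring lra.
Set Implicit Arguments.
Unset Strict Implicit.
Unset Printing Implicit Defensive.
Import Order.TTheory GRing.Theory Num.Theory.
Import numFieldNormedType.Exports.
Local Open Scope classical_set_scope.
Local Open Scope ring_scope.

(* In real terms, with Y and X the canonical lifts of y and of its polar surface
   [L], isothermicity gives Y_uv = sigma Y, and L being normal to y gives
     X_u = a1 (X + f Y) + f Y_u,  X_v = a2 (X - f Y) - f Y_v,  f = 1 or -1.
   The lift Y^* satisfies the same system with theta for f and m1, m2 for a1, a2;
   either system makes the mixed second derivative of X (of Y^* ) a multiple of X
   (of Y^* ), which is the reality of the Hopf differential of [L] (of y^* ).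
   With g = <X, Y^*>, the vector X + g Y - (f / theta) Y^* is null and normal to
   y^*, and comparing orientations shows that it spans the line [L^*]. Since its
   product with Y^*_uu is - theta g, non-degeneracy of [L^*] forces g <> 0; then
     X^* = (f theta / g) X + f theta Y - Y^* / g
   is the normalized lift of [L^*], and satisfies the system of a
   D^theta-transform of X. Exchanging L and R reverses the orientation of both
   frames, so the argument applies to [R] as well. *)

(** * Smooth maps on the plane *)

(** A D^theta-transform needs one normalized lift over the whole domain of every canonical lift,
    whereas polar frames exist only locally. All identities are therefore proved near a point; the
    normalized lift is determined by its line and its product -1 with X, so the local lifts agree
    and glue. The factor f is <X_u, Y_u>. Normality of X makes <X, Y_uu> and <X, Y_vv> opposite, and
    Y_uv parallel to Y makes <X, Y_uv> vanish; hence the tangential parts of X_u and X_v are f Y_u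
    and - f Y_v, and X induces the metric f^2 |dz|^2. For a canonical X this gives f^2 = 1, so that
    f is locally constant, and the compatibility of the mixed derivatives then ties the coefficient
    of Y to that of X. The factor - f / theta is the only one for which the null vector is
    orthogonal to Y^*_uu + Y^*_vv, and the final scaling by f theta / g is dictated by <X, X^*> =
    -1. *)

Section Smooth.
Variable R : realType.
Implicit Types (W : normedModType R) (U : set (plane R)).

Lemma near_derive_eq W (f g : plane R -> W) p w :
  (\forall q \near p, f q = g q) -> 'D_w f p = 'D_w g p.
Proof.
have [->|w0] := eqVneq w 0; first by rewrite !derive0.
by move=> fg; apply: near_eq_derive.
Qed.

Lemma near_derivable_eq W (f g : plane R -> W) p w :
  (\forall q \near p, f q = g q) -> derivable f p w -> derivable g p w.
Proof.
have [->|w0] := eqVneq w 0; first by move=> *; exact: derivable0.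
by move=> fg; apply: near_eq_derivable.
Qed.

(** Equality on an open set passes to the partial derivatives, so the induction on [k] continues
    with the derivatives on the same neighbourhoods. This is what allows maps known only through
    local formulas to be glued. *)
Lemma Ck_locally W k U (f g : plane R -> W) :
  (forall p, U p -> exists O,
    [/\ open O, O p, Ck k O g & forall q, O q -> f q = g q]) -> Ck k U f.
Proof.
have germ O p h1 h2 : open O -> O p -> (forall q, O q -> h1 q = h2 q) ->
    \forall q \near p, (h1 : plane R -> W) q = h2 q.
  by move=> oO Op e; near=> q; apply: e; near: q; exact: open_nbhs_nbhs.
elim: k U f g => [|k IH] U f g H.
  split=> //; move=> p /H [W0 [oO Op [cg _] e]].
  have eg := germ _ _ _ _ oO Op e.
  rewrite /prop_for /continuous_at (e _ Op); apply: cvg_trans (cg _ Op).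
  by apply: near_eq_cvg; apply: filterS eg => q ->.
split.
  move=> p /H [W0 [oO Op [cg _] e]].
  have eg := germ _ _ _ _ oO Op e.
  rewrite /prop_for /continuous_at (e _ Op); apply: cvg_trans (cg _ Op).
  by apply: near_eq_cvg; apply: filterS eg => q ->.
split.
- move=> p /H [W0 [oO Op [cg [dg _ _]] e]]; have eg := germ _ _ _ _ oO Op e.
  have eg' : \forall q \near p, g q = f q by apply: filterS eg => q ->.
  by have [d1 d2] := dg _ Op; split; apply: near_derivable_eq eg' _.
- apply: (IH _ _ (pu g)) => p /H [W0 [oO Op [cg [dg Cu _]] e]]; exists W0; split=> // q Oq.
  exact/near_derive_eq/(germ _ _ _ _ oO Oq e).
- apply: (IH _ _ (pv g)) => p /H [W0 [oO Op [cg [dg _ Cv]] e]]; exists W0; split=> // q Oq.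
  exact/near_derive_eq/(germ _ _ _ _ oO Oq e).
Unshelve. all: by end_near. Qed.

Lemma CkW W k U (f : plane R -> W) : Ck k.+1 U f -> Ck k U f.
Proof.
elim: k f => [|k IH] f [cf [df Cu Cv]]; first by split.
by split; [exact: cf | split; [exact: df | exact: IH _ Cu | exact: IH _ Cv]].
Qed.

Lemma Ck_sub W k U V (f : plane R -> W) : V `<=` U -> Ck k U f -> Ck k V f.
Proof.
move=> VU; elim: k f => [|k IH] f [cf H].
  by split=> // p /VU/cf.
have [df Cu Cv] := H; split; first by move=> p /VU/cf.
by split; [move=> p /VU/df | exact: IH _ Cu | exact: IH _ Cv].
Qed.

Lemma smooth_sub W U V (f : plane R -> W) : V `<=` U -> smooth_on U f -> smooth_on V f.
Proof. by move=> VU sf k; apply: Ck_sub VU (sf k). Qed.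

Lemma smooth_locally W U (f : plane R -> W) :
  (forall p, U p -> exists O g,
    [/\ open O, O p, smooth_on O g & forall q, O q -> f q = g q]) ->
  smooth_on U f.
Proof.
move=> H k; apply: (Ck_locally (g := f)) => p /H [W0 [g [oO Op sg e]]].
exists W0; split=> //; apply: (Ck_locally (g := g)) => q Oq.
by exists W0; split.
Qed.

Lemma Ck_ext W k U (f g : plane R -> W) : open U ->
  (forall q, U q -> f q = g q) -> Ck k U g -> Ck k U f.
Proof. by move=> oU e Cg; apply: (Ck_locally (g := g)) => p Up; exists U. Qed.

Lemma smooth_ext W U (f g : plane R -> W) : open U ->
  (forall q, U q -> f q = g q) -> smooth_on U g -> smooth_on U f.
Proof. by move=> oU e Cg k; apply: Ck_ext e (Cg k). Qed.

Lemma smooth_pu W U (f : plane R -> W) : smooth_on U f -> smooth_on U (pu f).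
Proof. by move=> sf k; have [_ []] := sf k.+1. Qed.

Lemma smooth_pv W U (f : plane R -> W) : smooth_on U f -> smooth_on U (pv f).
Proof. by move=> sf k; have [_ []] := sf k.+1. Qed.

Lemma smooth_derivable_u W U (f : plane R -> W) p : smooth_on U f -> U p ->
  derivable f p (1, 0).
Proof. by move=> sf Up; have [_ [df _ _]] := sf 1; case: (df p Up). Qed.

Lemma smooth_derivable_v W U (f : plane R -> W) p : smooth_on U f -> U p ->
  derivable f p (0, 1).
Proof. by move=> sf Up; have [_ [df _ _]] := sf 1; case: (df p Up). Qed.

Lemma smooth_continuous W U (f : plane R -> W) p : smooth_on U f -> U p ->
  {for p, continuous f}.
Proof. by move=> sf Up; have [cf _] := sf 0; exact: cf. Qed.

Lemma Ck_cst W k U (a : W) : Ck k U (fun=> a).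
Proof.
elim: k a => [|k IH] a.
  by split=> [p _|]; [exact: cvg_cst | exact: I].
split; first by move=> p _; exact: cvg_cst.
split.
- move=> p _; split; exact: (@derivable_cst _ _ _ a).
- have -> : pu (fun=> a) = fun=> 0.
    by apply/funext => p; exact: (@derive_cst _ _ _ a).
  exact: IH.
- have -> : pv (fun=> a) = fun=> 0.
    by apply/funext => p; exact: (@derive_cst _ _ _ a).
  exact: IH.
Qed.

Lemma smooth_cst W U (a : W) : smooth_on U (fun=> a).
Proof. by move=> k; exact: Ck_cst. Qed.

Lemma CkD W k U (f g : plane R -> W) : open U -> Ck k U f -> Ck k U g ->
  Ck k U (fun p => f p + g p).
Proof.
move=> oU; elim: k f g => [|k IH] f g [cf Hf] [cg Hg].
  by split=> // p Up; apply: cvgD; [exact: cf | exact: cg].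
have [df fu fv] := Hf; have [dg gu gv] := Hg.
split; first by move=> p Up; apply: cvgD; [exact: cf | exact: cg].
split.
- move=> p Up; have [d1 d2] := df _ Up; have [d3 d4] := dg _ Up.
  by split; [exact: derivableD d1 d3 | exact: derivableD d2 d4].
- apply: (Ck_ext (g := fun p => pu f p + pu g p)) => // [p Up|]; last exact: IH _ _ fu gu.
  by have [d1 _] := df _ Up; have [d2 _] := dg _ Up; exact: deriveD d1 d2.
- apply: (Ck_ext (g := fun p => pv f p + pv g p)) => // [p Up|]; last exact: IH _ _ fv gv.
  by have [_ d1] := df _ Up; have [_ d2] := dg _ Up; exact: deriveD d1 d2.
Qed.

Lemma CkM k U (f g : plane R -> R) : open U -> Ck k U f -> Ck k U g ->
  Ck k U (fun p => f p * g p).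
Proof.
move=> oU; elim: k f g => [|k IH] f g [cf Hf] [cg Hg].
  by split=> // p Up; apply: cvgM; [exact: cf | exact: cg].
have [df fu fv] := Hf; have [dg gu gv] := Hg.
have Cf : Ck k U f by exact: CkW (conj cf Hf).
have Cg : Ck k U g by exact: CkW (conj cg Hg).
split; first by move=> p Up; apply: cvgM; [exact: cf | exact: cg].
split.
- move=> p Up; have [d1 d2] := df _ Up; have [d3 d4] := dg _ Up.
  by split; [exact: derivableM d1 d3 | exact: derivableM d2 d4].
- apply: (Ck_ext (g := fun p => f p * pu g p + g p * pu f p)) => // [p Up|].
    by have [d1 _] := df _ Up; have [d2 _] := dg _ Up; exact: deriveM d1 d2.
  by apply: CkD oU _ _; [exact: IH _ _ Cf gu | exact: IH _ _ Cg fu].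
- apply: (Ck_ext (g := fun p => f p * pv g p + g p * pv f p)) => // [p Up|].
    by have [_ d1] := df _ Up; have [_ d2] := dg _ Up; exact: deriveM d1 d2.
  by apply: CkD oU _ _; [exact: IH _ _ Cf gv | exact: IH _ _ Cg fv].
Qed.

Lemma CkV k U (f : plane R -> R) : open U -> (forall p, U p -> f p != 0) ->
  Ck k U f -> Ck k U (fun p => (f p)^-1).
Proof.
move=> oU f0; elim: k => [|k IH] [cf Hf].
  by split=> // p Up; apply: cvgV; [exact: f0 | exact: cf].
have [df fu fv] := Hf.
have Cf : Ck k U f by exact: CkW (conj cf Hf).
split; first by move=> p Up; apply: cvgV; [exact: f0 | exact: cf].
have Q : Ck k U (fun p => -1 * ((f p)^-1 * (f p)^-1)).
  by apply: CkM => //; [exact: Ck_cst | apply: CkM => //; exact: IH].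
split.
- move=> p Up; have [d1 d2] := df _ Up.
  by split; [exact: derivableV (f0 _ Up) d1 | exact: derivableV (f0 _ Up) d2].
- apply: (Ck_ext (g := fun p => -1 * ((f p)^-1 * (f p)^-1) * pu f p)) => // [p Up|].
    have [d _] := df _ Up; rewrite [LHS](deriveV (f0 _ Up) d).
    by rewrite mulN1r -expr2 exprVn.
  exact: CkM oU Q fu.
- apply: (Ck_ext (g := fun p => -1 * ((f p)^-1 * (f p)^-1) * pv f p)) => // [p Up|].
    have [_ d] := df _ Up; rewrite [LHS](deriveV (f0 _ Up) d).
    by rewrite mulN1r -expr2 exprVn.
  exact: CkM oU Q fv.
Qed.

Lemma smoothD W U (f g : plane R -> W) : open U -> smooth_on U f -> smooth_on U g ->
  smooth_on U (fun p => f p + g p).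
Proof. by move=> oU sf sg k; exact: CkD. Qed.

Lemma smoothM U (f g : plane R -> R) : open U -> smooth_on U f -> smooth_on U g ->
  smooth_on U (fun p => f p * g p).
Proof. by move=> oU sf sg k; exact: CkM. Qed.

Lemma smoothV U (f : plane R -> R) : open U -> (forall p, U p -> f p != 0) ->
  smooth_on U f -> smooth_on U (fun p => (f p)^-1).
Proof. by move=> oU f0 sf k; exact: CkV. Qed.

Lemma smoothN U (f : plane R -> R) : open U -> smooth_on U f ->
  smooth_on U (fun p => - f p).
Proof.
move=> oU sf; apply: (smooth_ext (g := fun p => -1 * f p)) => //.
  by move=> q _; rewrite mulN1r.
by apply: smoothM => //; exact: smooth_cst.
Qed.

Lemma smooth_sum U n (f : 'I_n -> plane R -> R) : open U ->
  (forall i, smooth_on U (f i)) -> smooth_on U (fun p => \sum_i f i p).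
Proof.
move=> oU; elim: n f => [|n IH] f sf.
  apply: (smooth_ext (g := fun=> 0)) => // [q _|]; [exact: big_ord0 | exact: smooth_cst].
apply: (smooth_ext (g := fun p => f ord0 p + \sum_(i < n) f (lift ord0 i) p)) => //.
  by move=> q _; rewrite big_ord_recl.
by apply: smoothD => //; exact: (IH (fun i => f (lift ord0 i))).
Qed.

End Smooth.

(** * Symmetry of second partial derivatives *)

Section Schwarz.
Variable R : realType.

(** The mean value theorem is applied twice: in the first variable to [phi], the increment of [F] in
    the second one, and then in the second variable to [Fx t]. *)
Lemma mixed_MVT (F Fx Fxy : R -> R -> R) (x y h : R) : 0 < h ->
  (forall t s, t \in `[x, x + h]%R -> s \in `[y, y + h]%R ->
     is_derive t 1 (fun t => F t s) (Fx t s)) ->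
  (forall t s, t \in `[x, x + h]%R -> s \in `[y, y + h]%R ->
     is_derive s 1 (Fx t) (Fxy t s)) ->
  exists t s, [/\ t \in `[x, x + h]%R, s \in `[y, y + h]%R
    & F (x + h) (y + h) - F (x + h) y - (F x (y + h) - F x y) = Fxy t s * h * h].
Proof.
move=> h0 dF dFx.
have xh : x <= x + h by rewrite lerDl ltW.
have yh : y <= y + h by rewrite lerDl ltW.
have y0 : y \in `[y, y + h]%R by rewrite in_itv /= lexx.
have y1 : y + h \in `[y, y + h]%R by rewrite in_itv /= lexx andbT.
pose phi t := F t (y + h) - F t y.
have dphi t : t \in `[x, x + h]%R -> is_derive t 1 phi (Fx t (y + h) - Fx t y).
  by move=> tx; apply: is_deriveB; exact: dF.
have cphi : {within `[x, x + h], continuous phi}.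
  apply: derivable_within_continuous => t tx.
  by have [] := dphi _ tx.
have dphi' t : t \in `]x, x + h[%R -> is_derive t 1 phi (Fx t (y + h) - Fx t y).
  by move=> tx; apply: dphi; exact: subset_itv_oo_cc tx.
have [t tx phiE] := MVT_segment xh dphi' cphi.
have dFxt s : s \in `]y, y + h[%R -> is_derive s 1 (Fx t) (Fxy t s).
  by move=> sy; apply: dFx tx _; exact: subset_itv_oo_cc sy.
have cFxt : {within `[y, y + h], continuous (Fx t)}.
  apply: derivable_within_continuous => s sy.
  by have [] := dFx _ _ tx sy.
have [s sy FxE] := MVT_segment yh dFxt cFxt.
exists t, s; split=> //.
by move: phiE; rewrite /phi FxE !(addrC _ h) !addrK => ->.
Qed.

Lemma second_difference_eq (a b c d h l1 l2 : R) : h != 0 ->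
  a - b - (c - d) = l1 * h * h -> a - c - (b - d) = l2 * h * h -> l1 = l2.
Proof.
move=> h0 E1 E2; apply: (mulIf h0); apply: (mulIf h0); rewrite -E1 -E2; ring.
Qed.

Lemma dist_le_of_halves (a b c e : R) :
  `|a - c| < e / 2 -> `|b - c| < e / 2 -> `|b - a| <= e.
Proof.
move=> ac bc; rewrite -(subrK c b) -addrA (le_trans (ler_normD _ _)) //.
by rewrite (distrC c a) (splitr e) lerD // ltW.
Qed.

Lemma slice_u (f : plane R -> R) (a b : R) : derivable f (a, b) (1, 0) ->
  is_derive a 1 (fun t => f (t, b)) (pu f (a, b)).
Proof.
have E : (fun h : R => h^-1 *: (f (h *: ((1, 0) : plane R) + (a, b)) - f (a, b))) =
         (fun h : R => h^-1 *: ((fun t => f (t, b)) (h *: 1 + a) - (fun t => f (t, b)) a)).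
  apply/funext => h; congr (_ *: (f _ - _)).
  by congr pair; rewrite /= ?scaler0 ?add0r.
by move=> d; split; rewrite /pu /derivable /derive -E.
Qed.

Lemma slice_v (f : plane R -> R) (a b : R) : derivable f (a, b) (0, 1) ->
  is_derive b 1 (fun t => f (a, t)) (pv f (a, b)).
Proof.
have E : (fun h : R => h^-1 *: (f (h *: ((0, 1) : plane R) + (a, b)) - f (a, b))) =
         (fun h : R => h^-1 *: ((fun t => f (a, t)) (h *: 1 + b) - (fun t => f (a, t)) b)).
  apply/funext => h; congr (_ *: (f _ - _)).
  by congr pair; rewrite /= ?scaler0 ?add0r.
by move=> d; split; rewrite /pv /derivable /derive -E.
Qed.

(** Both mixed derivatives, each taken at some point of a small square with corner [p], equal the
    same second difference divided by the area; continuity at [p] brings both points back to [p]. *)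
Lemma pu_pv_comm (U : set (plane R)) (f : plane R -> R) p :
  open U -> U p -> smooth_on U f -> pu (pv f) p = pv (pu f) p.
Proof.
move=> oU Up sf.
have cA := smooth_continuous (smooth_pv (smooth_pu sf)) Up.
have cB := smooth_continuous (smooth_pu (smooth_pv sf)) Up.
apply/eqP; rewrite -subr_eq0 -normr_le0; apply/ler_addgt0Pr => e e0.
rewrite add0r.
have e20 : 0 < e / 2 by rewrite divr_gt0.
have NU : nbhs p U by exact: open_nbhs_nbhs.
have : \forall q \near p, [/\ U q, `|pv (pu f) p - pv (pu f) q| < e / 2 &
    `|pu (pv f) p - pu (pv f) q| < e / 2].
  have N1 : \forall q \near p, `|pv (pu f) p - pv (pu f) q| < e / 2.
    by move/cvgrPdist_lt : cA => /(_ _ e20).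
  have N2 : \forall q \near p, `|pu (pv f) p - pu (pv f) q| < e / 2.
    by move/cvgrPdist_lt : cB => /(_ _ e20).
  by apply: filterS3 NU N1 N2 => q Uq; split.
move=> /nbhs_ballP[r /= r0 rP].
(* Half the radius keeps the closed square of side [h] inside the open ball. *)
pose h := r / 2.
have h0 : 0 < h by rewrite divr_gt0.
have hr : h < r by rewrite /h; lra.
case: p Up cA cB NU rP => x y Up cA cB NU rP.
have box t s : t \in `[x, x + h]%R -> s \in `[y, y + h]%R -> ball (x, y) r (t, s).
  rewrite !in_itv /= => /andP[t1 t2] /andP[s1 s2]; split; rewrite /= /ball /=.
    by rewrite ler0_norm ?opprB; lra.
  by rewrite ler0_norm ?opprB; lra.
have [t [s [tx sy E1]]] : exists t s, [/\ t \in `[x, x + h]%R, s \in `[y, y + h]%R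
    & f (x + h, y + h) - f (x + h, y) - (f (x, y + h) - f (x, y)) = pv (pu f) (t, s) * h * h].
  apply: (@mixed_MVT (fun a b => f (a, b)) (fun a b => pu f (a, b)) (fun a b => pv (pu f) (a, b))); first exact: h0.
    move=> t s tx sy; apply: slice_u; apply: smooth_derivable_u sf _.
    by have [] := rP _ (box _ _ tx sy).
  move=> t s tx sy; apply: slice_v; apply: smooth_derivable_v (smooth_pu sf) _.
  by have [] := rP _ (box _ _ tx sy).
have [s' [t' [sy' tx' E2]]] : exists s t, [/\ s \in `[y, y + h]%R, t \in `[x, x + h]%R
    & f (x + h, y + h) - f (x, y + h) - (f (x + h, y) - f (x, y)) = pu (pv f) (t, s) * h * h].
  apply: (@mixed_MVT (fun b a => f (a, b)) (fun b a => pv f (a, b)) (fun b a => pu (pv f) (a, b))); first exact: h0.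
    move=> s' t' sy' tx'; apply: slice_v; apply: smooth_derivable_v sf _.
    by have [] := rP _ (box _ _ tx' sy').
  move=> s' t' sy' tx'; apply: slice_u; apply: smooth_derivable_u (smooth_pv sf) _.
  by have [] := rP _ (box _ _ tx' sy').
have E : pv (pu f) (t, s) = pu (pv f) (t', s').
  exact: second_difference_eq (lt0r_neq0 h0) E1 E2.
have [_ H1 _] := rP _ (box _ _ tx sy).
have [_ _ H2] := rP _ (box _ _ tx' sy').
rewrite E in H1; exact: dist_le_of_halves H1 H2.
Qed.
End Schwarz.

(** * The form of signature (4,2) and vector-valued maps *)

Section FormAlgebra.
Variable T : comNzRingType.
Implicit Types x y z : 'rV[T]_6.

Lemma form42C x y : form42 x y = form42 y x.
Proof. by apply: eq_bigr => i _; rewrite (mulrC (x 0 i)). Qed.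

Lemma form42Dl x y z : form42 (x + y) z = form42 x z + form42 y z.
Proof. by rewrite -big_split; apply: eq_bigr => i _; rewrite mxE mulrDl mulrDr. Qed.

Lemma form42Zl a x z : form42 (a *: x) z = a * form42 x z.
Proof. by rewrite mulr_sumr; apply: eq_bigr => i _; rewrite mxE; ring. Qed.

Lemma form42Dr x y z : form42 z (x + y) = form42 z x + form42 z y.
Proof. by rewrite !(form42C z) form42Dl. Qed.

Lemma form42Zr a x z : form42 z (a *: x) = a * form42 z x.
Proof. by rewrite !(form42C z) form42Zl. Qed.

Lemma form420l z : form42 0 z = 0.
Proof. by rewrite -(scale0r 0) form42Zl mul0r. Qed.

Lemma form420r z : form42 z 0 = 0.
Proof. by rewrite form42C form420l. Qed.

Definition sgn42 : 'M[T]_6 := \matrix_(i, j) ((-1) ^+ (4 <= i)%N *+ (i == j)).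

Lemma gram_mulmx m n (P : 'M[T]_(m, 6)) (Q : 'M[T]_(n, 6)) i j :
  (P *m sgn42 *m Q^T) i j = form42 (row i P) (row j Q).
Proof.
rewrite mxE; apply: eq_bigr => k _; rewrite !mxE (bigD1 k) //= big1 ?addr0.
  by rewrite !mxE eqxx mulr1n; ring.
by move=> l lk; rewrite !mxE (negbTE lk) mulr0n mulr0.
Qed.

Lemma det_sgn42 : \det sgn42 = 1.
Proof.
have -> : sgn42 = diag_mx (\row_i (-1) ^+ (4 <= i)%N).
  by apply/matrixP => i j; rewrite !mxE; case: eqP => [->|].
rewrite det_diag !big_ord_recl big_ord0 !mxE /=; ring.
Qed.
End FormAlgebra.

Lemma form42_map (T S : comNzRingType) (h : {rmorphism T -> S}) (x y : 'rV[T]_6) :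
  form42 (map_mx h x) (map_mx h y) = h (form42 x y).
Proof.
rewrite rmorph_sum; apply: eq_bigr => i _; rewrite !mxE !rmorphM /=.
by rewrite rmorphXn rmorphN1.
Qed.

Section VectorDerivatives.
Variable R : realType.
Implicit Types (F G : plane R -> 'rV[R]_6) (c : plane R -> R) (U : set (plane R)).

Lemma derivable_coord n (F' : plane R -> 'rV[R]_n) p w (i : 'I_n) : derivable F' p w ->
  derivable (fun q => F' q 0 i) p w.
Proof. by move/derivable_mxP => /(_ 0 i). Qed.

Lemma derive_coord n (F' : plane R -> 'rV[R]_n) p w (i : 'I_n) : derivable F' p w ->
  ('D_w F' p) 0 i = 'D_w (fun q => F' q 0 i) p.
Proof. by move=> dF; rewrite derive_mx // mxE. Qed.

Arguments derive_coord {n F' p w} i _.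
Arguments derivable_coord {n F' p w} i _.

Lemma derivable_of_coord n (F' : plane R -> 'rV[R]_n) p w : (forall i : 'I_n, derivable (fun q => F' q 0 i) p w) ->
  derivable F' p w.
Proof. by move=> dF; apply/derivable_mxP => i j; rewrite (ord1 i). Qed.

Lemma is_derive_scale c F p w dc dF : is_derive p w c dc -> is_derive p w F dF ->
  is_derive p w (fun q => c q *: F q) (dc *: F p + c p *: dF).
Proof.
move=> [dc1 dc2] [dF1 dF2].
have E i : (fun q => (c q *: F q) 0 i) = c * (fun q => F q 0 i).
  by apply/funext => q; rewrite mxE.
have d : derivable (fun q => c q *: F q) p w.
  apply: derivable_of_coord => i; rewrite E.
  apply: derivableM; first exact: dc1.
  exact: derivable_coord.
split; first exact: d.
apply/rowP => i; rewrite (derive_coord i d) E (deriveM dc1 (derivable_coord i dF1)).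
rewrite -(derive_coord i dF1) dc2 dF2 [RHS]mxE [in RHS]mxE [X in _ = _ + X]mxE.
by rewrite addrC (mulrC dc).
Qed.

Lemma is_derive_form F G p w dF dG : is_derive p w F dF -> is_derive p w G dG ->
  is_derive p w (fun q => form42 (F q) (G q)) (form42 dF (G p) + form42 (F p) dG).
Proof.
move=> [dF1 dF2] [dG1 dG2].
have E : (fun q => form42 (F q) (G q)) =
    \sum_(i < 6) ((-1) ^+ (4 <= i)%N *: ((fun q => F q 0 i) * (fun q => G q 0 i))).
  apply/funext => q; rewrite fct_sumE; apply: eq_bigr => i _.
  by [].
rewrite E -big_split /=.
apply: is_derive_sum => i.
apply: is_derive_eq.
  apply: is_deriveZ; apply: is_deriveM; apply: derivableP; exact: derivable_coord.
rewrite -mulrDr -(derive_coord i dF1) -(derive_coord i dG1) dF2 dG2.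
rewrite /GRing.scale /=; congr (_ * _); ring.
Qed.

(** Coordinates commute with [pu] and [pv], so smoothness of forms and multiples of vector maps
    reduces to sums and products of real functions. *)
Lemma smooth_coord n U (F : plane R -> 'rV[R]_n.+1) : open U ->
  smooth_on U F <-> forall i, smooth_on U (fun q => F q 0 i).
Proof.
move=> oU; split=> [sF i k|sF k].
  have : Ck k U F by exact: sF.
  elim: k F {sF} => [|k IH] F [cF H].
    split; last exact: I.
    move=> p Up; apply: (@continuous_comp _ _ _ F (fun M : 'rV[R]_n.+1 => M 0 i));
    [exact: cF | exact: coord_continuous].
  have [dF Fu Fv] := H; split.
    move=> p Up; apply: (@continuous_comp _ _ _ F (fun M : 'rV[R]_n.+1 => M 0 i));
    [exact: cF | exact: coord_continuous].
  split.
  - move=> p Up; have [d1 d2] := dF p Up.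
    by split; [exact: derivable_coord d1 | exact: derivable_coord d2].
  - apply: (Ck_ext (g := fun q => pu F q 0 i) oU _ (IH _ Fu)).
    by move=> q Uq; have [d _] := dF q Uq; exact: esym (derive_coord i d).
  - apply: (Ck_ext (g := fun q => pv F q 0 i) oU _ (IH _ Fv)).
    by move=> q Uq; have [_ d] := dF q Uq; exact: esym (derive_coord i d).
have : forall i, Ck k U (fun q => F q 0 i) by move=> i; exact: sF.
have cont (G : plane R -> 'rV[R]_n.+1) : (forall i p, U p -> {for p, continuous (fun q => G q 0 i)}) ->
    forall p, U p -> {for p, continuous G}.
  move=> cG p Up; apply/cvg_mx_entourageP => A entA.
  have /filter_forall : forall i : 'I_n.+1, \forall q \near p, A (G p 0 i, G q 0 i).
    move=> i; have := cG i p Up.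
    by move/cvg_app_entourageP => /(_ _ entA).
  apply: filterS => q H i j; rewrite (ord1 i).
  by rewrite inE.
elim: k F {sF} => [|k IH] F CF.
  split; last exact: I.
  by apply: cont => i; have [] := CF i.
split; first by apply: cont => i; have [] := CF i.
have dF p : U p -> derivable F p (1, 0) /\ derivable F p (0, 1).
  move=> Up; split; apply: derivable_of_coord => i.
    by have [_ [d _ _]] := CF i; have [d1 _] := d p Up; exact: d1.
  by have [_ [d _ _]] := CF i; have [_ d1] := d p Up; exact: d1.
split; first exact: dF.
- apply: IH => i; have [_ [_ Cu _]] := CF i.
  apply: Ck_ext oU _ Cu => q Uq; have [d _] := dF q Uq.
  exact: derive_coord d.
- apply: IH => i; have [_ [_ _ Cv]] := CF i.
  apply: Ck_ext oU _ Cv => q Uq; have [_ d] := dF q Uq.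
  exact: derive_coord d.
Qed.

Lemma smooth_form U F G : open U -> smooth_on U F -> smooth_on U G ->
  smooth_on U (fun q => form42 (F q) (G q)).
Proof.
move=> oU /(smooth_coord _ oU) sF /(smooth_coord _ oU) sG.
apply: smooth_sum => // i; apply: smoothM => //; first exact: smooth_cst.
exact: smoothM.
Qed.

Lemma smooth_scale U c F : open U -> smooth_on U c -> smooth_on U F ->
  smooth_on U (fun q => c q *: F q).
Proof.
move=> oU sc /(smooth_coord _ oU) sF; apply/(smooth_coord _ oU) => i.
apply: (smooth_ext (g := fun q => c q * F q 0 i)) => //.
  by move=> q _; rewrite mxE.
exact: smoothM.
Qed.

End VectorDerivatives.

(** * Partial derivatives and Wirtinger operators *)

Section Partials.
Variable R : realType.
Implicit Types (F G : plane R -> 'rV[R]_6) (c : plane R -> R) (U : set (plane R)).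

(* [pd false] is d/du and [pd true] is d/dv. *)
Definition pd (b : bool) (W : normedModType R) (f : plane R -> W) : plane R -> W :=
  if b then pv f else pu f.

Lemma smooth_pd b (W : normedModType R) U (f : plane R -> W) :
  smooth_on U f -> smooth_on U (pd b f).
Proof. by case: b; [exact: smooth_pv | exact: smooth_pu]. Qed.

Definition axis (b : bool) : plane R := if b then (0, 1) else (1, 0).

Lemma pdE b (W : normedModType R) (f : plane R -> W) p : pd b f p = 'D_(axis b) f p.
Proof. by case: b. Qed.

Lemma pd_is_derive b (W : normedModType R) U (f : plane R -> W) p :
  smooth_on U f -> U p -> is_derive p (axis b) f (pd b f p).
Proof.
move=> sf Up; rewrite pdE; apply: derivableP; case: b.
  exact: smooth_derivable_v sf Up.
exact: smooth_derivable_u sf Up.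
Qed.

Lemma is_derive_pd b (W : normedModType R) (f : plane R -> W) p df :
  is_derive p (axis b) f df -> pd b f p = df.
Proof. by move=> [_ <-]; rewrite pdE. Qed.

Lemma pd_eq b (W : normedModType R) U (f g : plane R -> W) p : open U -> U p ->
  (forall q, U q -> f q = g q) -> pd b f p = pd b g p.
Proof.
move=> oU Up fg; rewrite !pdE; apply: near_derive_eq.
by apply: filterS (open_nbhs_nbhs (conj oU Up)) => q; exact: fg.
Qed.

Lemma pd_cst b (W : normedModType R) U (f : plane R -> W) a p : open U -> U p ->
  (forall q, U q -> f q = a) -> pd b f p = 0.
Proof.
move=> oU Up fa; rewrite (pd_eq b oU Up fa) pdE; exact: derive_cst.
Qed.

Lemma pd_form b U F G p : smooth_on U F -> smooth_on U G -> U p ->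
  pd b (fun q => form42 (F q) (G q)) p = form42 (pd b F p) (G p) + form42 (F p) (pd b G p).
Proof.
move=> sF sG Up; apply: is_derive_pd.
exact: is_derive_form (pd_is_derive b sF Up) (pd_is_derive b sG Up).
Qed.

Lemma pd_scale b U c F p : smooth_on U c -> smooth_on U F -> U p ->
  pd b (fun q => c q *: F q) p = pd b c p *: F p + c p *: pd b F p.
Proof.
move=> sc sF Up; apply: is_derive_pd.
exact: is_derive_scale (pd_is_derive b sc Up) (pd_is_derive b sF Up).
Qed.

Lemma pdD b (W : normedModType R) U (f g : plane R -> W) p :
  smooth_on U f -> smooth_on U g -> U p ->
  pd b (fun q => f q + g q) p = pd b f p + pd b g p.
Proof.
move=> sf sg Up; apply: is_derive_pd.
exact: is_deriveD (pd_is_derive b sf Up) (pd_is_derive b sg Up).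
Qed.

Lemma pdM b U (f g : plane R -> R) p : smooth_on U f -> smooth_on U g -> U p ->
  pd b (fun q => f q * g q) p = f p * pd b g p + g p * pd b f p.
Proof.
move=> sf sg Up; apply: is_derive_pd.
exact: is_deriveM (pd_is_derive b sf Up) (pd_is_derive b sg Up).
Qed.

Lemma smoothZ U (a : R) F : open U -> smooth_on U F -> smooth_on U (fun q => a *: F q).
Proof. by move=> oU sF; apply: smooth_scale => //; exact: smooth_cst. Qed.

Lemma pdZ b U (a : R) F p : smooth_on U F -> U p ->
  pd b (fun q => a *: F q) p = a *: pd b F p.
Proof.
move=> sF Up; apply: is_derive_pd.
exact: is_deriveZ (pd_is_derive b sF Up).
Qed.

Lemma pd_comm U F p : open U -> U p -> smooth_on U F -> pu (pv F) p = pv (pu F) p.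
Proof.
move=> oU Up sF; apply/rowP => i.
have sFi : smooth_on U (fun q => F q 0 i) by have /(smooth_coord _ oU) := sF; apply.
have Eu q : U q -> pu F q 0 i = pu (fun q => F q 0 i) q.
  by move=> Uq; exact: derive_coord (smooth_derivable_u sF Uq).
have Ev q : U q -> pv F q 0 i = pv (fun q => F q 0 i) q.
  by move=> Uq; exact: derive_coord (smooth_derivable_v sF Uq).
transitivity (pu (fun q => pv F q 0 i) p).
  exact: derive_coord (smooth_derivable_u (smooth_pv sF) Up).
transitivity (pv (fun q => pu F q 0 i) p); last first.
  exact: esym (derive_coord i (smooth_derivable_v (smooth_pu sF) Up)).
transitivity (pu (pv (fun q => F q 0 i)) p); first exact: (pd_eq false oU Up Ev).
transitivity (pv (pu (fun q => F q 0 i)) p); first exact: pu_pv_comm oU Up sFi.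
by symmetry; exact: (pd_eq true oU Up Eu).
Qed.

Lemma pd_pdC a b U F p : open U -> U p -> smooth_on U F ->
  pd a (pd b F) p = pd b (pd a F) p.
Proof.
move=> oU Up sF; case: a; case: b; [by [] | | | by []].
  exact: esym (pd_comm oU Up sF).
exact: pd_comm oU Up sF.
Qed.

Lemma dmapE F p w : dmap F p w = w.1 *: pu F p + w.2 *: pv F p.
Proof. by []. Qed.
End Partials.
#[local] Opaque pu pv derive.

(** * Real and imaginary parts of complex vectors and of the Wirtinger derivatives *)

Section ComplexVectors.
Local Open Scope complex_scope.
Variable R : realType.
Implicit Types (x y : 'rV[R[i]]_6) (a b : 'rV[R]_6) (k : R[i]).

Lemma cvec_eq x y : reV x = reV y -> imV x = imV y -> x = y.
Proof.
move=> /rowP re /rowP im; apply/rowP => i; move: (re i) (im i); rewrite !mxE.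
by case: (x 0 i) => ? ?; case: (y 0 i) => ? ? /= -> ->.
Qed.

Lemma reVD x y : reV (x + y) = reV x + reV y.
Proof. by apply/rowP => i; rewrite !mxE; case: (x 0 i); case: (y 0 i). Qed.
Lemma imVD x y : imV (x + y) = imV x + imV y.
Proof. by apply/rowP => i; rewrite !mxE; case: (x 0 i); case: (y 0 i). Qed.
Lemma reVZ k x : reV (k *: x) = complex.Re k *: reV x - complex.Im k *: imV x.
Proof. by apply/rowP => i; rewrite !mxE; case: (x 0 i); case: k. Qed.
Lemma imVZ k x : imV (k *: x) = complex.Re k *: imV x + complex.Im k *: reV x.
Proof. by apply/rowP => i; rewrite !mxE; case: (x 0 i); case: k. Qed.
Lemma reV_cplx a : reV (cplx a) = a.
Proof. by apply/rowP => i; rewrite !mxE. Qed.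
Lemma imV_cplx a : imV (cplx a) = 0.
Proof. by apply/rowP => i; rewrite !mxE. Qed.
Lemma reV_conj x : reV (conjV x) = reV x.
Proof. by apply/rowP => i; rewrite !mxE; case: (x 0 i). Qed.
Lemma imV_conj x : imV (conjV x) = - imV x.
Proof. by apply/rowP => i; rewrite !mxE; case: (x 0 i). Qed.
Lemma reVN x : reV (- x) = - reV x.
Proof. by rewrite -scaleN1r reVZ /= oppr0 scale0r subr0 scaleN1r. Qed.
Lemma imVN x : imV (- x) = - imV x.
Proof. by rewrite -scaleN1r imVZ /= oppr0 scale0r addr0 scaleN1r. Qed.

Lemma cplxE x : x = cplx (reV x) + 'i *: cplx (imV x).
Proof.
by apply: cvec_eq; rewrite ?(reVD, imVD, reVZ, imVZ, reV_cplx, imV_cplx) /=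
  ?(scaler0, scale0r, scale1r, subr0, addr0, add0r).
Qed.

Lemma form_cplx a b : form42 (cplx a) (cplx b) = (form42 a b)%:C.
Proof. exact: (form42_map (real_complex R)). Qed.

Lemma half_cplx : 2^-1 = (2^-1 : R)%:C.
Proof. by rewrite fmorphV rmorph_nat. Qed.

Lemma Re_half : complex.Re (2^-1 : R[i]) = 2^-1.
Proof. by rewrite half_cplx. Qed.

Lemma Im_half : complex.Im (2^-1 : R[i]) = 0.
Proof. by rewrite half_cplx. Qed.

Lemma Re_i : complex.Re ('i : R[i]) = 0. Proof. by []. Qed.
Lemma Im_i : complex.Im ('i : R[i]) = 1. Proof. by []. Qed.

Definition cvecE := (reVD, imVD, reVN, imVN, reVZ, imVZ, reV_cplx, imV_cplx,
  Re_half, Im_half, Re_i, Im_i).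

Implicit Type G : plane R -> 'rV[R[i]]_6.

(** Here [a], [b] stand for the u-derivatives of the real and imaginary parts of a complex map and
    [c], [d] for their v-derivatives; the first two equations concern d/dz, the last two d/dzbar. *)
Lemma wirtinger_parts a b c d :
  [/\ reV (2^-1 *: (cplx a + 'i *: cplx b - 'i *: (cplx c + 'i *: cplx d))) =
        2^-1 *: (a + d),
      imV (2^-1 *: (cplx a + 'i *: cplx b - 'i *: (cplx c + 'i *: cplx d))) =
        2^-1 *: (b - c),
      reV (2^-1 *: (cplx a + 'i *: cplx b + 'i *: (cplx c + 'i *: cplx d))) =
        2^-1 *: (a - d) &
      imV (2^-1 *: (cplx a + 'i *: cplx b + 'i *: (cplx c + 'i *: cplx d))) =
        2^-1 *: (b + c)].
Proof. by split; rewrite !cvecE; apply/rowP => i; rewrite !mxE; ring. Qed.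

Lemma reV_dz G p :
  reV (dz G p) = 2^-1 *: (pu (fun q => reV (G q)) p + pv (fun q => imV (G q)) p).
Proof. by have [E _ _ _] := wirtinger_parts (pu (fun q => reV (G q)) p)
  (pu (fun q => imV (G q)) p) (pv (fun q => reV (G q)) p) (pv (fun q => imV (G q)) p). Qed.

Lemma imV_dz G p :
  imV (dz G p) = 2^-1 *: (pu (fun q => imV (G q)) p - pv (fun q => reV (G q)) p).
Proof. by have [_ E _ _] := wirtinger_parts (pu (fun q => reV (G q)) p)
  (pu (fun q => imV (G q)) p) (pv (fun q => reV (G q)) p) (pv (fun q => imV (G q)) p). Qed.

Lemma reV_dzb G p :
  reV (dzb G p) = 2^-1 *: (pu (fun q => reV (G q)) p - pv (fun q => imV (G q)) p).
Proof. by have [_ _ E _] := wirtinger_parts (pu (fun q => reV (G q)) p)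
  (pu (fun q => imV (G q)) p) (pv (fun q => reV (G q)) p) (pv (fun q => imV (G q)) p). Qed.

Lemma imV_dzb G p :
  imV (dzb G p) = 2^-1 *: (pu (fun q => imV (G q)) p + pv (fun q => reV (G q)) p).
Proof. by have [_ _ _ E] := wirtinger_parts (pu (fun q => reV (G q)) p)
  (pu (fun q => imV (G q)) p) (pv (fun q => reV (G q)) p) (pv (fun q => imV (G q)) p). Qed.

Implicit Types (Y : plane R -> 'rV[R]_6) (U : set (plane R)).

Let reV_cplxf Y : (fun q => reV (cplxf Y q)) = Y.
Proof. by apply/funext => q; exact: reV_cplx. Qed.

Let pd_imV_cplxf (b : bool) Y p : pd b (fun q => imV (cplxf Y q)) p = 0.
Proof. by apply: (@pd_cst _ b _ setT _ 0) openT I _ => q _; exact: imV_cplx. Qed.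

Let pu_imV_cplxf Y p : pu (fun q => imV (cplxf Y q)) p = 0.
Proof. exact: (pd_imV_cplxf false). Qed.

Let pv_imV_cplxf Y p : pv (fun q => imV (cplxf Y q)) p = 0.
Proof. exact: (pd_imV_cplxf true). Qed.

Lemma reV_Yz Y p : reV (Yz Y p) = 2^-1 *: pu Y p.
Proof. by rewrite reV_dz reV_cplxf pv_imV_cplxf addr0. Qed.

Lemma imV_Yz Y p : imV (Yz Y p) = - 2^-1 *: pv Y p.
Proof. by rewrite imV_dz reV_cplxf pu_imV_cplxf sub0r scalerN scaleNr. Qed.

Lemma reV_Yzb Y p : reV (Yzb Y p) = 2^-1 *: pu Y p.
Proof. by rewrite reV_dzb reV_cplxf pv_imV_cplxf subr0. Qed.

Lemma imV_Yzb Y p : imV (Yzb Y p) = 2^-1 *: pv Y p.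
Proof. by rewrite imV_dzb reV_cplxf pu_imV_cplxf add0r. Qed.

Let reV_Yz_fun Y : (fun q => reV (Yz Y q)) = (fun q => 2^-1 *: pu Y q).
Proof. by apply/funext => q; exact: reV_Yz. Qed.

Let imV_Yz_fun Y : (fun q => imV (Yz Y q)) = (fun q => - 2^-1 *: pv Y q).
Proof. by apply/funext => q; exact: imV_Yz. Qed.

Lemma reV_Yzzb U Y p : smooth_on U Y -> U p ->
  reV (Yzzb Y p) = 4^-1 *: (pu (pu Y) p + pv (pv Y) p).
Proof.
move=> sY Up; rewrite reV_dzb reV_Yz_fun imV_Yz_fun.
rewrite [pu _ p](pdZ false _ (smooth_pu sY) Up) [pv _ p](pdZ true _ (smooth_pv sY) Up) /=.
by move: (pu (pu Y) p) (pv (pv Y) p) => a b; apply/rowP => i; rewrite !mxE; field.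
Qed.

Lemma reV_Yzz U Y p : smooth_on U Y -> U p ->
  reV (Yzz Y p) = 4^-1 *: (pu (pu Y) p - pv (pv Y) p).
Proof.
move=> sY Up; rewrite reV_dz reV_Yz_fun imV_Yz_fun.
rewrite [pu _ p](pdZ false _ (smooth_pu sY) Up) [pv _ p](pdZ true _ (smooth_pv sY) Up) /=.
by move: (pu (pu Y) p) (pv (pv Y) p) => a b; apply/rowP => i; rewrite !mxE; field.
Qed.

Lemma imV_Yzz U Y p : open U -> smooth_on U Y -> U p ->
  imV (Yzz Y p) = - 2^-1 *: pu (pv Y) p.
Proof.
move=> oU sY Up; rewrite imV_dz reV_Yz_fun imV_Yz_fun.
rewrite [pv _ p](pdZ true _ (smooth_pu sY) Up) [pu _ p](pdZ false _ (smooth_pv sY) Up) /=.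
by rewrite (pd_comm oU Up sY); move: (pv (pu Y) p) => a; apply/rowP => i; rewrite !mxE; field.
Qed.

Lemma form_cplx2 a b c d :
  form42 (cplx a + 'i *: cplx b) (cplx c + 'i *: cplx d) =
  ((form42 a c - form42 b d) +i* (form42 a d + form42 b c))%C.
Proof.
have ii (k : R[i]) : 'i * ('i * k) = - k by rewrite mulrA -expr2 sqr_i mulN1r.
rewrite form42Dl !form42Dr !form42Zl !form42Zr !form_cplx ii.
by apply/eqP; rewrite eq_complex /=; apply/andP; split; apply/eqP; ring.
Qed.

Lemma form_Yz_conformal Y p (e : R) : form42 (pu Y p) (pu Y p) = e ->
  form42 (pv Y p) (pv Y p) = e -> form42 (pu Y p) (pv Y p) = 0 ->
  form42 (Yz Y p) (Yz Y p) = 0 /\ form42 (Yz Y p) (Yzb Y p) = (e / 2)%:C.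
Proof.
move=> uu vv uv; have vu : form42 (pv Y p) (pu Y p) = 0 by rewrite form42C.
rewrite (cplxE (Yz Y p)) (cplxE (Yzb Y p)) reV_Yz imV_Yz reV_Yzb imV_Yzb.
move: (pu Y p) (pv Y p) uu vv uv vu => a b aa bb ab ba.
by rewrite !form_cplx2 !form42Zl !form42Zr aa bb ab ba; split; congr Complex; field.
Qed.
End ComplexVectors.

(** * Lifts *)

Section Lifts.
Local Open Scope complex_scope.
Variable R : realType.
Implicit Types (U V : set (plane R)) (y : plane R -> {vspace 'rV[R]_6})
  (X Y : plane R -> 'rV[R]_6).

Lemma qproj_eqP (a b : 'rV[R]_6) : a <> 0 -> qproj a = qproj b ->
  exists2 c, c != 0 & a = c *: b.
Proof.
move=> a0 ab; have : a \in qproj b by rewrite -ab memv_line.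
move/vlineP => [c ac]; exists c => //; apply/eqP => c0.
by apply: a0; rewrite ac c0 scale0r.
Qed.

Lemma qprojZ (c : R) (a : 'rV[R]_6) : c != 0 -> qproj (c *: a) = qproj a.
Proof.
move=> c0; apply: subv_anti; apply/andP; split; rewrite /qproj -memvE.
  by rewrite memvZ // memv_line.
by rewrite -[X in X \in _](scalerK c0) memvZ // memv_line.
Qed.

Lemma local_lift_sub U V y Y : V `<=` U -> local_lift U y Y -> local_lift V y Y.
Proof. by move=> VU [sY H]; split; [exact: smooth_sub sY | move=> p /VU/H]. Qed.

Lemma canonical_lift_sub U V y Y : V `<=` U -> canonical_lift U y Y -> canonical_lift V y Y.
Proof.
move=> VU [lY H]; split; first exact: local_lift_sub lY.
by move=> p w /VU; exact: H.
Qed.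

Lemma local_lift_null U y Y p : local_lift U y Y -> U p -> form42 (Y p) (Y p) = 0.
Proof. by move=> [_ H] /H[]. Qed.

Lemma local_lift_tangent b U y Y p : open U -> local_lift U y Y -> U p ->
  form42 (Y p) (pd b Y p) = 0.
Proof.
move=> oU lY Up; have sY := lY.1.
have : pd b (fun q => form42 (Y q) (Y q)) p = 0.
  by apply: (pd_cst b oU Up) => q Uq; exact: local_lift_null lY Uq.
rewrite (pd_form b sY sY Up) (form42C (pd b Y p)) => H; lra.
Qed.

Lemma form_lincomb (a b : R) (x z : 'rV[R]_6) :
  form42 (a *: x + b *: z) (a *: x + b *: z) =
  a * a * form42 x x + 2 * (a * b) * form42 x z + b * b * form42 z z.
Proof.
by rewrite form42Dl !form42Dr !form42Zl !form42Zr (form42C z x); ring.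
Qed.

Lemma form_orthonormal (u v : 'rV[R]_6) :
  (forall a b : R, form42 (a *: u + b *: v) (a *: u + b *: v) = a ^+ 2 + b ^+ 2) ->
  [/\ form42 u u = 1, form42 v v = 1 & form42 u v = 0].
Proof.
move=> H; have E a b : a * a * form42 u u + 2 * (a * b) * form42 u v + b * b * form42 v v
    = a * a + b * b by rewrite -form_lincomb H !expr2.
have E1 := E 1 0; have E2 := E 0 1; have E3 := E 1 1.
by split; lra.
Qed.

Lemma canonical_lift_metric a b U y Y p : canonical_lift U y Y -> U p ->
  form42 (pd a Y p) (pd b Y p) = (a == b)%:R.
Proof.
move=> [_ H] Up.
have [uu vv uv] : [/\ form42 (pu Y p) (pu Y p) = 1, form42 (pv Y p) (pv Y p) = 1
    & form42 (pu Y p) (pv Y p) = 0].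
  by apply: form_orthonormal => a' b'; exact: (H p (a', b') Up).
by case: a; case: b => /=; [exact: vv | rewrite form42C; exact: uv | exact: uv | exact: uu].
Qed.

(* Differentiating <Y_a, Y> = 0. *)
Lemma canonical_lift_second a b U y Y p : open U -> canonical_lift U y Y -> U p ->
  form42 (Y p) (pd a (pd b Y) p) = - (a == b)%:R.
Proof.
move=> oU cY Up; have sY := cY.1.1.
have : pd a (fun q => form42 (Y q) (pd b Y q)) p = 0.
  by apply: (pd_cst a oU Up) => q Uq; exact: local_lift_tangent oU cY.1 Uq.
rewrite (pd_form a sY (smooth_pd b sY) Up) (canonical_lift_metric a b cY Up).
by move/eqP; rewrite addr_eq0 => /eqP ->; rewrite opprK.
Qed.

Lemma canonical_lift_metric_derive a b c U y Y p : open U -> canonical_lift U y Y -> U p ->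
  form42 (pd c (pd a Y) p) (pd b Y p) + form42 (pd a Y p) (pd c (pd b Y) p) = 0.
Proof.
move=> oU cY Up; have sY := cY.1.1.
rewrite -(pd_form c (smooth_pd a sY) (smooth_pd b sY) Up).
by apply: (pd_cst c oU Up) => q Uq; exact: canonical_lift_metric cY Uq.
Qed.

(** The equations along u and along v differ only by this sign in front of [theta] or [f], so both
    directions are treated at once. *)
Definition sg (b : bool) : R := (-1) ^+ b.

Lemma sg_sqr b : sg b * sg b = 1.
Proof. by rewrite /sg -expr2 sqrr_sign. Qed.

(* In real terms, [kappa] is real iff Y_uv is proportional to Y. *)
Definition conjugate_lines (M : set (plane R)) y := forall U Y,
  open U -> U `<=` M -> canonical_lift U y Y ->
  forall p, U p -> exists sigma : R, pu (pv Y) p = sigma *: Y p.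

(** The imaginary part of Y_zz is - Y_uv / 2. A real [kappa] contributes nothing to it, so only the
    multiple of Y remains. *)
Lemma isothermic_conjugate_lines (M : set (plane R)) y :
  isothermic M y -> conjugate_lines M y.
Proof.
move=> [_ H] U Y oU UM cY p Up.
have [s [kappa [[_ _ hopf] real]]] := H U Y oU UM cY.
have [+ _] := hopf p Up; have [_ kR] := real p Up.
move/(congr1 (@imV R)); rewrite (imV_Yzz oU cY.1.1 Up) imVD imVZ imV_cplx reV_cplx.
have -> : imV (kappa p) = 0.
  have : imV (kappa p) = - imV (kappa p) by rewrite -imV_conj kR.
  move/rowP => k0; apply/rowP => i; have := k0 i; rewrite !mxE => ?; lra.
rewrite scaler0 add0r addr0 => E.
exists (-2 * complex.Im (- (s p / 2))); rewrite -scalerA -E scalerA.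
by rewrite mulrNN mulfV ?scale1r.
Qed.

Lemma half_parts (k : R[i]) :
  complex.Re (k / 2) = complex.Re k / 2 /\ complex.Im (k / 2) = complex.Im k / 2.
Proof. by case: k => k1 k2; rewrite half_cplx /=; split; ring. Qed.

(** The transform equation with [k] for mu, [z] for the z-derivative of the transform and [zb] for
    the zbar-derivative of the surface. One direction reads the hypothesis on [ystar] in real terms,
    the other returns the conclusion to complex form. *)
Lemma pair_equation_parts (k : R[i]) (t : R) (z zb : 'rV[R[i]]_6) (u' v' u v x y0 : 'rV[R]_6) :
  reV z = 2^-1 *: u' -> imV z = - 2^-1 *: v' ->
  reV zb = 2^-1 *: u -> imV zb = 2^-1 *: v ->
  z = (k / 2) *: cplx x + t%:C *: (zb + (k^*%C / 2) *: cplx y0) <->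
  u' = complex.Re k *: (x + t *: y0) + t *: u /\
  v' = - complex.Im k *: (x - t *: y0) - t *: v.
Proof.
move=> z1 z2 zb1 zb2.
have [r1 i1] := half_parts k; have [r2 i2] := half_parts k^*%C.
have [r3 i3] : complex.Re k^*%C = complex.Re k /\ complex.Im k^*%C = - complex.Im k by case: k {r1 i1 r2 i2}.
set w := RHS.
have wr : reV w = 2^-1 *: (complex.Re k *: (x + t *: y0) + t *: u).
  rewrite reVD reVZ reVZ reVD imVD reVZ imVZ r1 i1 r2 i2 r3 i3 !reV_cplx !imV_cplx zb1 zb2.
  by apply/rowP => i; rewrite !mxE /=; field.
have wi : imV w = - 2^-1 *: (- complex.Im k *: (x - t *: y0) - t *: v).
  rewrite imVD imVZ imVZ reVD imVD reVZ imVZ r1 i1 r2 i2 r3 i3 !reV_cplx !imV_cplx zb1 zb2.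
  by apply/rowP => i; rewrite !mxE /=; field.
have h0 : (2^-1 : R) != 0 by rewrite invr_eq0 pnatr_eq0.
split=> [E|[E1 E2]]; last by apply: cvec_eq; rewrite ?wr ?wi ?z1 ?z2 ?E1 ?E2.
split; first by apply: (scalerI h0); rewrite -wr -E z1.
have h1 : (- 2^-1 : R) != 0 by rewrite oppr_eq0.
by apply: (scalerI h1); rewrite -wi -E z2.
Qed.

Lemma Dtheta_pair (M : set (plane R)) theta y ystar U Y :
  Dtheta_transform M theta y ystar -> open U -> U `<=` M -> canonical_lift U y Y ->
  exists Ys (m : bool -> plane R -> R),
    [/\ local_lift U ystar Ys, forall p, U p -> form42 (Y p) (Ys p) = -1,
        forall b, smooth_on U (m b)
      & forall b p, U p -> pd b Ys p =
          m b p *: (Ys p + (sg b * theta) *: Y p) + (sg b * theta) *: pd b Y p].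
Proof.
move=> [_ H] oU UM cY; have [Ys [lYs YYs [mu [[smu1 smu2] Ysz]]]] := H U Y oU UM cY.
exists Ys, (fun b p => if b then - complex.Im (mu p) else complex.Re (mu p)).
split=> //.
  by case; [exact: smoothN | ].
move=> b p Up.
have [Eu Ev] := (pair_equation_parts (mu p) theta (Ys p) (Y p) (reV_Yz Ys p) (imV_Yz Ys p)
  (reV_Yzb Y p) (imV_Yzb Y p)).1 (Ysz p Up).
case: b; rewrite /sg /=; [rewrite Ev expr1 mulN1r !scaleNr // | by rewrite Eu expr0 mul1r].
Qed.
End Lifts.

(** * The real form of the transform equation *)

Section Pairs.
Variable R : realType.
Implicit Types (U V : set (plane R)) (y : plane R -> {vspace 'rV[R]_6})
  (X Y : plane R -> 'rV[R]_6).

(* With X = Y^* and t = theta this is the equation of the D^theta-transform, where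
   mu = m false - i m true. With t = 1 or -1 it also relates the canonical lift X
   of a polar surface to Y. *)
Definition line_pair U (t : R) X Y (m : bool -> plane R -> R) := forall b p, U p ->
  pd b X p = m b p *: (X p + (sg R b * t) *: Y p) + (sg R b * t) *: pd b Y p.

Lemma pd_pair c U (k : R) (m : plane R -> R) X Y (G : plane R -> 'rV[R]_6) p :
  open U -> smooth_on U m -> smooth_on U X -> smooth_on U Y -> smooth_on U G -> U p ->
  pd c (fun q => m q *: (X q + k *: Y q) + k *: G q) p =
  pd c m p *: (X p + k *: Y p) + m p *: (pd c X p + k *: pd c Y p) + k *: pd c G p.
Proof.
move=> oU sm sX sY sG Up; have skY := smoothZ k oU sY.
have sXY := smoothD oU sX skY.
rewrite (pdD c (smooth_scale oU sm sXY) (smoothZ k oU sG) Up).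
rewrite (pd_scale c sm sXY Up) (pdD c sX skY Up).
by rewrite (pdZ c k sY Up) (pdZ c k sG Up).
Qed.

Lemma line_pair_second b c U t X Y m p : open U -> smooth_on U X -> smooth_on U Y ->
  (forall b, smooth_on U (m b)) -> line_pair U t X Y m -> U p ->
  pd c (pd b X) p = pd c (m b) p *: (X p + (sg R b * t) *: Y p) +
    m b p *: (pd c X p + (sg R b * t) *: pd c Y p) + (sg R b * t) *: pd c (pd b Y) p.
Proof.
move=> oU sX sY sm pr Up; rewrite (pd_eq c oU Up (pr b)).
exact: (pd_pair c (sg R b * t) oU (sm b) sX sY (smooth_pd b sY) Up).
Qed.

Lemma pair_conjugate_alg (t k1 k2 m1 m2 s : R) (x y0 xu xv yu yv z : 'rV[R]_6) :
  t != 0 -> (forall a b : R, a *: x + b *: y0 = 0 -> a = 0 /\ b = 0) ->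
  xu = m1 *: (x + t *: y0) + t *: yu -> xv = m2 *: (x - t *: y0) - t *: yv ->
  z = k1 *: (x - t *: y0) + m2 *: (xu - t *: yu) - t *: (s *: y0) ->
  z = k2 *: (x + t *: y0) + m1 *: (xv + t *: yv) + t *: (s *: y0) ->
  z = (k1 + m1 * m2) *: x.
Proof.
move=> t0 indep -> -> E1 E2.
have K : (k1 - k2) *: x + (t * (2 * m1 * m2 - k1 - k2 - 2 * s)) *: y0 = 0.
  by rewrite -(subrr z) {1}E1 E2; apply/rowP => i; rewrite !mxE; ring.
have [K1 K2] := indep _ _ K.
have {}K2 : s = m1 * m2 - k1.
  by move/eqP: K2; rewrite mulf_eq0 (negbTE t0) /= => /eqP; lra.
by rewrite E1 K2; apply/rowP => i; rewrite !mxE; ring.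
Qed.

Lemma line_pair_conjugate U t X Y m p (sigma : R) :
  open U -> smooth_on U X -> smooth_on U Y -> (forall b, smooth_on U (m b)) ->
  line_pair U t X Y m -> U p -> t != 0 ->
  (forall a b : R, a *: X p + b *: Y p = 0 -> a = 0 /\ b = 0) ->
  pu (pv Y) p = sigma *: Y p -> exists tau : R, pu (pv X) p = tau *: X p.
Proof.
move=> oU sX sY sm pr Up t0 indep Yuv.
have Yvu : pv (pu Y) p = sigma *: Y p by rewrite -(pd_comm oU Up sY).
have := line_pair_second true false oU sX sY sm pr Up.
have := line_pair_second false true oU sX sY sm pr Up.
have := pr true p Up; have := pr false p Up.
rewrite /sg /= expr0 expr1 mul1r mulN1r Yuv Yvu !scaleNr -(pd_comm oU Up sX).
move=> Xu Xv E1 E2.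
by eexists; exact: pair_conjugate_alg t0 indep Xu Xv E2 E1.
Qed.

(** By continuity [c] keeps the sign of [c p] near [p], which excludes the root [- c p]. The set [U]
    may be disconnected, so constancy holds only on a smaller neighbourhood. *)
Lemma locally_constant_of_sqr U (c : plane R -> R) (k : R) p : open U -> U p ->
  smooth_on U c -> k != 0 -> (forall q, U q -> c q ^+ 2 = k) ->
  exists W, [/\ open W, W p, W `<=` U & forall q, W q -> c q = c p].
Proof.
move=> oU Up sc k0 ck.
have cp0 : 0 < c p * c p.
  by rewrite -expr2 lt0r sqr_ge0 andbT ck.
have oW : open [set q | U q /\ 0 < c q * c p].
  rewrite openE => q [Uq cq].
  have NU : nbhs q U by exact: open_nbhs_nbhs.
  have cc : {for q, continuous (fun q => c q * c p)}.
    by apply: cvgM; [exact: smooth_continuous sc Uq | exact: cvg_cst].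
  have NC : \forall q' \near q, 0 < c q' * c p by exact: (cvgr_gt _ cc).
  by apply: filterS2 NU NC => q' Uq'; split.
exists [set q | U q /\ 0 < c q * c p]; split=> //.
  by move=> q [].
move=> q [Uq cq].
have : (c q - c p) * (c q + c p) = 0 by rewrite -subr_sqr !ck ?subrr.
move/eqP; rewrite mulf_eq0 => /orP[/eqP|/eqP] E; first by lra.
exfalso; have E' : c q = - c p by lra.
by move: cq; rewrite E' mulNr oppr_gt0 ltNge (ltW cp0).
Qed.
End Pairs.

(** * Frames adapted to a polar surface *)

Section Frames.
Variable R : realType.
Implicit Types x r l n w : 'rV[R]_6.

Definition rows6 (a b c d e f : 'rV[R]_6) : 'M[R]_6 :=
  \matrix_(i < 6) nth 0 [:: a; b; c; d; e; f] i.

(** A change of frame given by its rows. Missing entries are read as the default 0, so a lower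
    triangular table stops each row at the diagonal. *)
Definition tablemx (t : seq (seq R)) : 'M[R]_6 := \matrix_(i, j) (nth [::] t i)`_j.

Lemma det_tablemx t : (forall i, size (nth [::] t i) <= i.+1)%N ->
  \det (tablemx t) = \prod_(i < 6) (nth [::] t i)`_i.
Proof.
move=> st; rewrite det_trig; first by apply: eq_bigr => i _; rewrite mxE.
apply/is_trig_mxP => i j ij; rewrite mxE nth_default //.
exact: leq_trans (st i) ij.
Qed.

Lemma mul_tablemx t (a b c d e f : 'rV[R]_6) :
  let comb i := (nth [::] t i)`_0 *: a + (nth [::] t i)`_1 *: b +
    (nth [::] t i)`_2 *: c + (nth [::] t i)`_3 *: d + (nth [::] t i)`_4 *: e +
    (nth [::] t i)`_5 *: f in
  tablemx t *m rows6 a b c d e f =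
  rows6 (comb 0%N) (comb 1%N) (comb 2%N) (comb 3%N) (comb 4%N) (comb 5%N).
Proof.
move=> comb; apply/matrixP => i j; rewrite mxE.
have -> : rows6 (comb 0%N) (comb 1%N) (comb 2%N) (comb 3%N) (comb 4%N) (comb 5%N) i j
    = comb i 0 j.
  by rewrite mxE; case: i => [[|[|[|[|[|[|i]]]]]] //=].
by rewrite !big_ord_recl big_ord0 !mxE /=; ring.
Qed.

(** Since [sgn42] has determinant 1, [\det P * \det Q] is the determinant of the matrix of mutual
    products. The orientations of two frames can thus be compared without expressing one in the
    other. *)
Lemma gram_trig (P Q : 'M[R]_6) :
  (forall i j : 'I_6, (i < j)%N -> form42 (row i P) (row j Q) = 0) ->
  \det P * \det Q = \prod_(i < 6) form42 (row i P) (row i Q).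
Proof.
move=> H; transitivity (\det (P *m sgn42 R *m Q^T)).
  by rewrite !det_mulmx det_sgn42 det_tr mulr1.
rewrite det_trig; first by apply: eq_bigr => i _; rewrite gram_mulmx.
by apply/is_trig_mxP => i j ij; rewrite gram_mulmx H.
Qed.

Lemma row_rows6 a b c d e f i : row i (rows6 a b c d e f) = nth 0 [:: a; b; c; d; e; f] i.
Proof. exact: rowK. Qed.

Lemma ortho_rows6_eq0 (a b c d e f w : 'rV[R]_6) : \det (rows6 a b c d e f) != 0 ->
  form42 a w = 0 -> form42 b w = 0 -> form42 c w = 0 -> form42 d w = 0 ->
  form42 e w = 0 -> form42 f w = 0 -> w = 0.
Proof.
move=> D0 aw bw cw dw ew fw.
have U1 : rows6 a b c d e f *m sgn42 R \in unitmx.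
  by rewrite unitmxE det_mulmx det_sgn42 mulr1 unitfE.
apply: trmx_inj; apply: (can_inj (mulKmx U1)); rewrite trmx0 mulmx0.
apply/matrixP => i j; rewrite gram_mulmx row_rows6 row_id mxE.
by case: i => [[|[|[|[|[|[|i]]]]]] //=].
Qed.

(* [x], [xu], [xv], [d] are the values of Y, Y_u, Y_v and Y_uu + Y_vv; [n] that
   of N; the null normal vectors [r] and [l] are distinguished by the sign [s]. *)
Record polar_basis (s : R) (x xu xv d n r l : 'rV[R]_6) : Prop := PolarBasis {
  pb_xx : form42 x x = 0;
  pb_xxu : form42 x xu = 0;
  pb_xxv : form42 x xv = 0;
  pb_uu : form42 xu xu = 1;
  pb_vv : form42 xv xv = 1;
  pb_uv : form42 xu xv = 0;
  pb_nx : form42 n x = -1;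
  pb_nu : form42 n xu = 0;
  pb_nv : form42 n xv = 0;
  pb_nn : form42 n n = 0;
  pb_n : forall w, form42 w x = 0 -> form42 w xu = 0 -> form42 w xv = 0 ->
    form42 w d = 0 -> form42 w n = 0;
  pb_rx : form42 r x = 0;
  pb_ru : form42 r xu = 0;
  pb_rv : form42 r xv = 0;
  pb_rd : form42 r d = 0;
  pb_lx : form42 l x = 0;
  pb_lu : form42 l xu = 0;
  pb_lv : form42 l xv = 0;
  pb_ld : form42 l d = 0;
  pb_rr : form42 r r = 0;
  pb_ll : form42 l l = 0;
  pb_rl : form42 r l = -1;
  pb_or : 0 < s * \det (rows6 x xu xv r l n) }.

(** Membership of N in V is recorded dually by [pb_n]: what is orthogonal to the generators of V is
    orthogonal to N. Normal vectors satisfy its four premises. *)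
Lemma pb_rn s x xu xv d n r l : polar_basis s x xu xv d n r l -> form42 r n = 0.
Proof. by case=> *; auto. Qed.

Lemma pb_ln s x xu xv d n r l : polar_basis s x xu xv d n r l -> form42 l n = 0.
Proof. by case=> *; auto. Qed.

(** Up to the sign -1, [x] is dual to [n] and [r] to [l], while [xu] and [xv] are dual to
    themselves. The difference of the two sides is orthogonal to all six vectors, which are
    independent because [pb_or] makes their determinant nonzero. *)
Lemma pb_expand s x xu xv d n r l w : polar_basis s x xu xv d n r l ->
  w = (- form42 w n) *: x + form42 w xu *: xu + form42 w xv *: xv +
      (- form42 w l) *: r + (- form42 w r) *: l + (- form42 w x) *: n.
Proof.
move=> B; have rn := pb_rn B; have ln := pb_ln B; case: B.
move=> xx xxu xxv uu vv uv nx nu nv nn _ rx ru rv _ lx lu lv _ rr ll rl o.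
apply/eqP; rewrite -subr_eq0; apply/eqP; rewrite -scaleN1r.
have D0 : \det (rows6 x xu xv r l n) != 0.
  by apply/eqP => D0; rewrite D0 mulr0 ltxx in o.
have [ux vx vu] : [/\ form42 xu x = 0, form42 xv x = 0 & form42 xv xu = 0].
  by rewrite !(form42C _ x) (form42C xv xu).
have [xr ur vr] : [/\ form42 x r = 0, form42 xu r = 0 & form42 xv r = 0].
  by rewrite !(form42C _ r).
have [xl ul vl] : [/\ form42 x l = 0, form42 xu l = 0 & form42 xv l = 0].
  by rewrite !(form42C _ l).
have [xn un vn] : [/\ form42 x n = -1, form42 xu n = 0 & form42 xv n = 0].
  by rewrite !(form42C _ n).
have [nr nl lr] : [/\ form42 n r = 0, form42 n l = 0 & form42 l r = -1].
  by rewrite !(form42C n) (form42C l r).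
by apply: (ortho_rows6_eq0 D0);
  rewrite !(form42Dr, form42Zr) (form42C _ w);
  rewrite ?(xx, xxu, xxv, uu, vv, uv, nx, nu, nv, nn, rx, ru, rv, lx, lu, lv, rr, ll, rl, rn, ln);
  rewrite ?(ux, vx, vu, xr, ur, vr, xl, ul, vl, xn, un, vn, nr, nl, lr); ring.
Qed.

Lemma pb_perp s x xu xv d n r l w : polar_basis s x xu xv d n r l ->
  form42 w x = 0 -> form42 w xu = 0 -> form42 w xv = 0 -> form42 w d = 0 ->
  w = (- form42 w l) *: r + (- form42 w r) *: l.
Proof.
move=> B wx wu wv wd; rewrite {1}(pb_expand w B) wx wu wv (pb_n B) //.
by rewrite !oppr0 !scale0r !add0r addr0.
Qed.

Lemma pb_scale s x xu xv d n r l c : c != 0 -> polar_basis s x xu xv d n r l ->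
  polar_basis s x xu xv d n (c^-1 *: r) (c *: l).
Proof.
move=> c0 [xx xxu xxv uu vv uv nx nu nv nn nw rx ru rv rd lx lu lv ld rr ll rl o].
split=> //; rewrite ?form42Zl ?form42Zr ?rx ?ru ?rv ?rd ?lx ?lu ?lv ?ld ?rr ?ll ?rl ?mulr0 //.
  by rewrite mulrA mulVf // mul1r.
have := mul_tablemx [:: [:: 1]; [:: 0; 1]; [:: 0; 0; 1]; [:: 0; 0; 0; c^-1];
  [:: 0; 0; 0; 0; c]; [:: 0; 0; 0; 0; 0; 1]] x xu xv r l n.
rewrite /= !scale0r !scale1r !add0r !addr0 => /(congr1 determinant).
rewrite det_mulmx det_tablemx; last by case=> [|[|[|[|[|[|[|i]]]]]]].
rewrite !big_ord_recl big_ord0 /= => <-.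
by rewrite !mul1r mulr1 mulVf // mul1r.
Qed.
End Frames.

(** * The null normal directions of the transform *)

Section TransformedBasis.
Variable R : realType.
Implicit Types x r l n w : 'rV[R]_6.

(* For w = L, R and a suitable k, [adj] gives the null normal directions of y^*. *)
Definition adj x ys (k : R) w : 'rV[R]_6 := w + form42 w ys *: x + k *: ys.

Lemma adj_ys x ys k w : form42 x ys = -1 -> form42 ys ys = 0 -> form42 (adj x ys k w) ys = 0.
Proof. by move=> xy yy; rewrite /adj !form42Dl !form42Zl xy yy; ring. Qed.

Lemma adj_x x ys k w : form42 x x = 0 -> form42 x ys = -1 -> form42 w x = 0 ->
  form42 (adj x ys k w) x = - k.
Proof. by move=> xx xy wx; rewrite /adj !form42Dl !form42Zl xx (form42C ys) xy wx; ring. Qed.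

(** The contributions - m t k of [x] and t k m of [xu] cancel for every [k], so first-order
    normality leaves [k] free for the second-order condition. *)
Lemma adj_tangent x xu ys ysu k m t w : form42 x x = 0 -> form42 x xu = 0 ->
  form42 x ys = -1 -> form42 ys ys = 0 -> form42 xu ys = m ->
  ysu = m *: (ys + t *: x) + t *: xu ->
  form42 w x = 0 -> form42 w xu = 0 -> form42 (adj x ys k w) ysu = 0.
Proof.
move=> xx xxu xy yy uy -> wx wu.
rewrite !form42Dr !form42Zr form42Dr form42Zr (adj_ys k w xy yy) (adj_x k xx xy wx).
rewrite /adj !form42Dl !form42Zl wu xxu (form42C ys) uy; ring.
Qed.

(** The second argument is Y^*_uu, with [k1] the derivative of [m]. For a general [k] in place of
    [- (f / t)] the product is t (- f - g - k t), where g = <w, ys>; the chosen value removes [f].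
    What remains is odd in [t], hence cancels between u and v. *)
Lemma adj_second x xu xuu ys ysu f m k1 t w : t != 0 -> form42 x x = 0 ->
  form42 x xu = 0 -> form42 x ys = -1 -> form42 ys ys = 0 -> form42 xu ys = m ->
  ysu = m *: (ys + t *: x) + t *: xu ->
  form42 xu xu = 1 -> form42 x xuu = -1 -> form42 ysu xu + form42 ys xuu = k1 ->
  form42 w x = 0 -> form42 w xu = 0 -> form42 w xuu = - f ->
  form42 (adj x ys (- (f / t)) w)
    (k1 *: (ys + t *: x) + m *: (ysu + t *: xu) + t *: xuu) = - (t * form42 w ys).
Proof.
move=> t0 xx xxu xy yy uy ysuE uu xuux k1E wx wu wuu.
rewrite !(form42Dr _ _ (adj _ _ _ _)) !form42Zr !(form42Dr _ _ (adj _ _ _ _)) !form42Zr.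
rewrite (adj_ys _ w xy yy) (adj_x _ xx xy wx).
rewrite (adj_tangent _ xx xxu xy yy uy ysuE wx wu).
rewrite /adj !form42Dl !form42Zl wu xxu (form42C ys xu) uy wuu xuux.
have -> : form42 ys xuu = k1 - (m * m + t).
  rewrite -k1E ysuE !form42Dl !form42Zl !form42Dl !form42Zl xxu uu (form42C ys xu) uy; ring.
field; exact: t0.
Qed.

Lemma adj_null x ys k w : form42 x x = 0 -> form42 x ys = -1 -> form42 ys ys = 0 ->
  form42 w x = 0 -> form42 w w = 0 -> form42 (adj x ys k w) (adj x ys k w) = 0.
Proof.
move=> xx xy yy wx ww; rewrite /adj !form42Dl !form42Zl !form42Dr !form42Zr.
rewrite xx xy yy wx ww (form42C x w) (form42C ys) wx (form42C ys x) xy; ring.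
Qed.

Lemma adj_adj x ys k k' w w' : form42 x x = 0 -> form42 x ys = -1 -> form42 ys ys = 0 ->
  form42 w x = 0 -> form42 w' x = 0 ->
  form42 (adj x ys k w) (adj x ys k' w') = form42 w w'.
Proof.
move=> xx xy yy wx wx'; rewrite /adj !form42Dl !form42Zl !form42Dr !form42Zr.
rewrite xx xy yy wx (form42C x w') wx' (form42C ys w') (form42C ys x) xy; ring.
Qed.

Section Orientation.
Variables (s : R) (x xu xv d n r l z zu zv dz n' r' l' ys ysu ysv dys : 'rV[R]_6).
Variables (c theta m1 m2 kl kr : R).
Hypotheses (B : polar_basis s x xu xv d n r l)
  (B' : polar_basis s z zu zv dz n' r' l')
  (zE : z = c *: ys) (zuE : zu = c *: ysu) (zvE : zv = c *: ysv) (dzE : dz = c *: dys)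
  (ct : c ^+ 2 * theta ^+ 2 = 1)
  (xy : form42 x ys = -1) (yy : form42 ys ys = 0)
  (uy : form42 xu ys = m1) (vy : form42 xv ys = m2)
  (ysuE : ysu = m1 *: (ys + theta *: x) + theta *: xu)
  (ysvE : ysv = m2 *: (ys + (- theta) *: x) + (- theta) *: xv)
  (ld : form42 (adj x ys kl l) dys = 0) (rd : form42 (adj x ys kr r) dys = 0).

Let L := adj x ys kl l.
Let A := adj x ys kr r.

(* Otherwise r' and l' would be multiples of L and A in this order, and the
   Gram matrix of the two bases would be triangular with negative determinant. *)
Lemma transformed_polar : exists2 e, e != 0 & l' = e *: L.
Proof.
have xx := pb_xx B; have xxu := pb_xxu B; have xxv := pb_xxv B.
have lx := pb_lx B; have rx := pb_rx B.
have c0 : c != 0.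
  by apply: contra_eq_neq ct => ->; rewrite expr0n mul0r eq_sym oner_eq0.
(* Such vectors are orthogonal to [z], [zu], [zv] and [dz], hence lie in the normal plane spanned by
   [r'] and [l']. *)
have perp w k : form42 w x = 0 -> form42 w xu = 0 -> form42 w xv = 0 ->
    form42 (adj x ys k w) dys = 0 ->
    adj x ys k w = (- form42 (adj x ys k w) l') *: r' + (- form42 (adj x ys k w) r') *: l'.
  move=> wx wu wv wd; apply: (pb_perp B').
  - by rewrite zE form42Zr (adj_ys k w xy yy) mulr0.
  - by rewrite zuE form42Zr (adj_tangent k xx xxu xy yy uy ysuE wx wu) mulr0.
  - by rewrite zvE form42Zr (adj_tangent k xx xxv xy yy vy ysvE wx wv) mulr0.
  - by rewrite dzE form42Zr wd mulr0.
have EL := perp l kl lx (pb_lu B) (pb_lv B) ld.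
have EA := perp r kr rx (pb_ru B) (pb_rv B) rd.
have LL := adj_null kl xx xy yy lx (pb_ll B).
have AA := adj_null kr xx xy yy rx (pb_rr B).
have AL := adj_adj kr kl xx xy yy rx lx; rewrite (pb_rl B) in AL.
move: EL EA LL AA AL; rewrite -/L -/A.
set a1 := - form42 L l'; set a2 := - form42 L r'.
set b1 := - form42 A l'; set b2 := - form42 A r'.
move=> EL EA LL AA AL.
have rr' := pb_rr B'; have ll' := pb_ll B'; have rl' := pb_rl B'.
(* A null vector of a Lorentzian plane lies on one of its two null lines. The product -1 of [A] and
   [L] keeps them on different lines, so only the matching of the lines remains to be decided. *)
have a12 : a1 * a2 = 0.
  move: LL; rewrite {1 2}EL !form42Dl !form42Zl !form42Dr !form42Zr rr' ll' rl' (form42C l') rl'; lra.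
have b12 : b1 * b2 = 0.
  move: AA; rewrite {1 2}EA !form42Dl !form42Zl !form42Dr !form42Zr rr' ll' rl' (form42C l') rl'; lra.
have ab : b1 * a2 + b2 * a1 = 1.
  move: AL; rewrite {1}EL {1}EA !form42Dl !form42Zl !form42Dr !form42Zr rr' ll' rl' (form42C l') rl'; lra.
move/eqP: a12; rewrite mulf_eq0 => /orP[/eqP a10|/eqP a20].
  have a20 : a2 != 0.
    apply/eqP => a20; move: ab; rewrite a10 a20; lra.
  exists a2^-1; first by rewrite invr_eq0.
  by rewrite EL a10 scale0r add0r scalerA mulVf // scale1r.
exfalso.
have ab' : b2 * a1 = 1 by move: ab; rewrite a20 mulr0 add0r.
have b20 : b2 != 0 by apply/eqP => b20; move: ab'; rewrite b20; lra.
have b10 : b1 = 0 by move/eqP: b12; rewrite mulf_eq0 (negbTE b20) orbF => /eqP.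
have rE : r' = b2 *: L.
  by rewrite EL a20 scale0r addr0 scalerA ab' scale1r.
have lE : l' = a1 *: A.
  by rewrite EA b10 scale0r add0r scalerA (mulrC a1) ab' scale1r.
(* Adding multiples of [x], whose product with [ys] is -1, makes these vectors orthogonal to [ys].
   Every row of [Q] except [x] is then orthogonal to [z], and the table of products with [P] becomes
   triangular. *)
pose xu' := xu + m1 *: x; pose xv' := xv + m2 *: x.
pose rt := r + form42 r ys *: x; pose lt := l + form42 l ys *: x.
pose Q := rows6 x xu' xv' rt lt ys.
have QE : \det Q = \det (rows6 x xu xv r l n).
  (* The last row is the expansion of [ys] by [pb_expand]; its diagonal entry [- form42 ys x] is 1,
     so the change of frame is unimodular. *)
  have := mul_tablemx [:: [:: 1]; [:: m1; 1]; [:: m2; 0; 1];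
    [:: form42 r ys; 0; 0; 1]; [:: form42 l ys; 0; 0; 0; 1];
    [:: - form42 ys n; form42 ys xu; form42 ys xv; - form42 ys l; - form42 ys r; - form42 ys x]]
    x xu xv r l n.
  rewrite /= !scale0r !scale1r !addr0 -(pb_expand ys B) (addrC _ xu) (addrC _ xv) (addrC _ r) (addrC _ l).
  move/(congr1 determinant); rewrite -/Q => <-.
  rewrite det_mulmx det_tablemx; last by case=> [|[|[|[|[|[|[|i]]]]]]].
  by rewrite !big_ord_recl big_ord0 /= (form42C ys x) xy; ring.
pose P := rows6 z zu zv r' l' n'.
have yx : form42 ys x = -1 by rewrite form42C.
have [ux vx] : form42 xu x = 0 /\ form42 xv x = 0 by rewrite !(form42C _ x).
have vu : form42 xv xu = 0 by rewrite form42C (pb_uv B).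
have [yu yv] : form42 ys xu = m1 /\ form42 ys xv = m2 by rewrite !(form42C ys).
have [xl xr] : form42 x l = 0 /\ form42 x r = 0 by rewrite !(form42C x).
have [ul ur] : form42 xu l = 0 /\ form42 xu r = 0.
  by rewrite !(form42C xu) (pb_lu B) (pb_ru B).
have [vl vr] : form42 xv l = 0 /\ form42 xv r = 0.
  by rewrite !(form42C xv) (pb_lv B) (pb_rv B).
have [yl yr] : form42 ys l = form42 l ys /\ form42 ys r = form42 r ys.
  by rewrite !(form42C ys).
have lr : form42 l r = -1 by rewrite form42C (pb_rl B).
have PQ : \det P * \det Q = -1.
  have ny : form42 n' ys = - c^-1.
    have := pb_nx B'; rewrite zE form42Zr => h.
    by apply: (mulfI c0); rewrite h mulrN mulfV.
  have E (i j : 'I_6) : (i <= j)%N -> form42 (row i P) (row j Q) =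
      (nth 0 [:: - c; c * theta; - (c * theta); - b2; - a1; - c^-1] i) *+ (i == j).
    rewrite !row_rows6 zuE zvE zE rE lE ysuE ysvE /L /A /adj /xu' /xv' /rt /lt.
    by case: i => [[|[|[|[|[|[|i]]]]]] hi]; case: j => [[|[|[|[|[|[|j]]]]]] hj] //= _;
      rewrite ?mulr1n ?mulr0n;
      rewrite ?(form42Dl, form42Zl) ?(form42Dr, form42Zr);
      rewrite ?xx ?xy ?yy ?uy ?vy ?yx ?ux ?vx ?vu ?yu ?yv ?xl ?xr ?ul ?ur ?vl ?vr ?yl ?yr ?lr ?ny;
      rewrite ?xxu ?xxv ?(pb_uu B) ?(pb_vv B) ?(pb_uv B) ?lx ?rx ?(pb_ll B) ?(pb_rr B) ?(pb_rl B);
      rewrite ?(pb_lu B) ?(pb_lv B) ?(pb_ru B) ?(pb_rv B);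
      ring.
  rewrite gram_trig; last by move=> i j ij; rewrite E ?(ltnW ij) // -val_eqE ltn_eqF.
  under eq_bigr do rewrite E // eqxx mulr1n.
  rewrite !big_ord_recl big_ord0 /=.
  transitivity (- (c ^+ 2 * theta ^+ 2) * (b2 * a1)); last by rewrite ct ab' mulr1.
  by field.
have o : 0 < s * \det Q by rewrite QE; exact: pb_or B.
have o' : 0 < s * \det P by exact: pb_or B'.
have := mulr_gt0 o o'.
have -> : s * \det Q * (s * \det P) = s ^+ 2 * (\det P * \det Q) by ring.
by rewrite PQ mulrN1 oppr_gt0 ltNge sqr_ge0.
Qed.
End Orientation.
End TransformedBasis.

(** * Polar surfaces *)

Section Polar.
Local Open Scope complex_scope.
Variable R : realType.
Implicit Types (U V M : set (plane R)) (y l : plane R -> {vspace 'rV[R]_6})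
  (X Y N r : plane R -> 'rV[R]_6).

Definition polar_basis_at (s : R) Y N r X p := polar_basis s (Y p) (pu Y p) (pv Y p)
  (pu (pu Y) p + pv (pv Y) p) (N p) (r p) (X p).

Definition polar_frame (s : R) U Y N r X := [/\ smooth_on U r, smooth_on U X &
  forall p, U p -> polar_basis_at s Y N r X p].

Lemma form_span0 (k : 'rV[R]_6) (t : seq 'rV[R]_6) w :
  (forall v, v \in t -> form42 k v = 0) -> w \in <<t>>%VS -> form42 k w = 0.
Proof.
elim: t w => [|v t IH] w H.
  by rewrite span_nil memv0 => /eqP ->; rewrite form42C form420l.
rewrite span_cons => /memv_addP[v1 /vlineP[c ->] [v2 v2t ->]].
rewrite form42Dr form42Zr (H v) ?mem_head // (IH v2) ?mulr0 ?addr0 //.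
by move=> v' v't; apply: H; rewrite inE v't orbT.
Qed.

Lemma form_cplxl (k : 'rV[R]_6) (z : 'rV[R[i]]_6) :
  form42 (cplx k) z = (form42 k (reV z) +i* form42 k (imV z))%C.
Proof.
rewrite {1}(cplxE z) form42Dr form42Zr !form_cplx.
by apply/eqP; rewrite eq_complex /=; apply/andP; split; apply/eqP; ring.
Qed.

Lemma form_cplx_Yz_eq0 Y p (k : 'rV[R]_6) : form42 (cplx k) (Yz Y p) = 0 ->
  form42 k (pu Y p) = 0 /\ form42 k (pv Y p) = 0.
Proof.
rewrite form_cplxl reV_Yz imV_Yz; move: (pu Y p) (pv Y p) => a b.
rewrite !form42Zr => /eqP; rewrite eq_complex /= => /andP[/eqP E1 /eqP E2].
by split; lra.
Qed.

Lemma normal_vec_perp U Y p k : smooth_on U Y -> U p -> normal_vec Y p k ->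
  [/\ form42 k (Y p) = 0, form42 k (pu Y p) = 0, form42 k (pv Y p) = 0
    & form42 k (pu (pu Y) p + pv (pv Y) p) = 0].
Proof.
move=> sY Up H.
have mem v : v \in [:: Y p; reV (Yz Y p); imV (Yz Y p); reV (Yzzb Y p)] -> form42 k v = 0.
  by move=> vt; apply: H; exact: memv_span.
move: mem; rewrite reV_Yz imV_Yz (reV_Yzzb sY Up).
move: (Y p) (pu Y p) (pv Y p) (pu (pu Y) p + _) => x xu xv d mem.
have H1 := mem x (mem_head _ _).
have := mem (2^-1 *: xu); rewrite !inE eqxx orbT form42Zr => /(_ isT) H2.
have := mem (- 2^-1 *: xv); rewrite !inE eqxx !orbT form42Zr => /(_ isT) H3.
have := mem (4^-1 *: d); rewrite !inE eqxx !orbT form42Zr => /(_ isT) H4.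
by clear -H1 H2 H3 H4; split; lra.
Qed.

Lemma Vbundle_perp U Y p k w : smooth_on U Y -> U p ->
  form42 k (Y p) = 0 -> form42 k (pu Y p) = 0 -> form42 k (pv Y p) = 0 ->
  form42 k (pu (pu Y) p + pv (pv Y) p) = 0 -> w \in Vbundle Y p -> form42 k w = 0.
Proof.
move=> sY Up; rewrite /Vbundle reV_Yz imV_Yz (reV_Yzzb sY Up).
move: (Y p) (pu Y p) (pv Y p) (pu (pu Y) p + _) => x xu xv d kx ku kv kd.
apply: form_span0 => v; rewrite !inE => /or4P[] /eqP ->; first exact: kx.
- by rewrite form42Zr ku mulr0.
- by rewrite form42Zr kv mulr0.
- by rewrite form42Zr kd mulr0.
Qed.

Lemma det_xrow6 (i j : 'I_6) (A : 'M[R]_6) : i != j -> \det (xrow i j A) = - \det A.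
Proof. by move=> ij; rewrite xrowE det_mulmx det_perm odd_tperm ij expr1 mulN1r. Qed.

Let i3 : 'I_6 := @Ordinal 6 3 isT.
Let i4 : 'I_6 := @Ordinal 6 4 isT.
Let i5 : 'I_6 := @Ordinal 6 5 isT.

(** This exchange and the next one translate between [pos_oriented], which lists N before the null
    normals, and [polar_basis], which lists it last. *)
Lemma det_rows6_swap35 (a b c n r l : 'rV[R]_6) :
  \det (rows6 a b c n l r) = - \det (rows6 a b c r l n).
Proof.
rewrite -(@det_xrow6 i3 i5) //; congr determinant; apply/matrixP => i j.
rewrite !mxE; congr (fun_of_matrix _ _ _).
by case: i => [[|[|[|[|[|[|i]]]]]] //= hi]; rewrite permE.
Qed.

Lemma det_rows6_swap34 (a b c n r l : 'rV[R]_6) :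
  \det (rows6 a b c r l n) = - \det (rows6 a b c l r n).
Proof.
rewrite -(@det_xrow6 i3 i4) //; congr determinant; apply/matrixP => i j.
rewrite !mxE; congr (fun_of_matrix _ _ _).
by case: i => [[|[|[|[|[|[|i]]]]]] //= hi]; rewrite permE.
Qed.

Lemma basis_of_normal_frame (s : R) U y Y N r X p : open U -> canonical_lift U y Y -> U p ->
  N p \in Vbundle Y p -> form42 (cplx (N p)) (Yz Y p) = 0 ->
  form42 (N p) (N p) = 0 -> form42 (N p) (Y p) = -1 ->
  normal_vec Y p (r p) -> normal_vec Y p (X p) ->
  form42 (r p) (r p) = 0 -> form42 (X p) (X p) = 0 -> form42 (r p) (X p) = -1 ->
  0 < s * \det (rows6 (Y p) (pu Y p) (pv Y p) (r p) (X p) (N p)) ->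
  polar_basis_at s Y N r X p.
Proof.
move=> oU cY Up NV Nz NN NY nr nX rr XX rX o.
have sY := cY.1.1.
have [Nu Nv] := form_cplx_Yz_eq0 Nz.
have [rx ru rv rd] := normal_vec_perp sY Up nr.
have [Xx Xu Xv Xd] := normal_vec_perp sY Up nX.
have Nw w : form42 w (Y p) = 0 -> form42 w (pu Y p) = 0 -> form42 w (pv Y p) = 0 ->
    form42 w (pu (pu Y) p + pv (pv Y) p) = 0 -> form42 w (N p) = 0.
  by move=> w1 w2 w3 w4; exact: Vbundle_perp sY Up w1 w2 w3 w4 NV.
have xx := local_lift_null cY.1 Up.
have xu := local_lift_tangent false oU cY.1 Up.
have xv := local_lift_tangent true oU cY.1 Up.
have uu := canonical_lift_metric false false cY Up.
have vv := canonical_lift_metric true true cY Up.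
have uv := canonical_lift_metric false true cY Up.
exact: PolarBasis xx xu xv uu vv uv NY Nu Nv NN Nw rx ru rv rd Xx Xu Xv Xd rr XX rX o.
Qed.

(** Passing from N, R, L to R, L, N is a cyclic and hence even permutation, while passing to L, R, N
    is odd; this is the origin of the two signs. *)
Lemma null_frame_basis U y Y L Rt : open U -> null_frame U y Y L Rt ->
  exists N, polar_frame 1 U Y N Rt L /\ polar_frame (-1) U Y N L Rt.
Proof.
move=> oU [cY sL sR [N [[sN HN] H]]]; exists N; split; split=> // p Up.
  have [NV [Nz _ NN NY]] := HN p Up; have [nL nR [LL RR] LR o] := H p Up.
  apply: (basis_of_normal_frame oU cY Up NV Nz NN NY nR nL RR LL); first by rewrite form42C.
  by rewrite mul1r det_rows6_swap34 -(det_rows6_swap35 _ _ _ (N p) (L p) (Rt p)).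
have [NV [Nz _ NN NY]] := HN p Up; have [nL nR [LL RR] LR o] := H p Up.
apply: (basis_of_normal_frame oU cY Up NV Nz NN NY nL nR LL RR LR).
by rewrite mulN1r -(det_rows6_swap35 _ _ _ (N p) (L p) (Rt p)).
Qed.

(* The left polar surface for s = 1, the right one for s = -1. *)
Definition polar_map (s : R) M y l := forall p, M p -> exists U Y N r X,
  [/\ open U, U p & U `<=` M] /\
  [/\ canonical_lift U y Y, polar_frame s U Y N r X & forall q, U q -> l q = qproj (X q)].

Lemma left_polar_map M y l : left_polar M y l -> polar_map 1 M y l.
Proof.
move=> H p /H[U [Y [L [Rt [oU Up UM nf lE]]]]].
have [N [fL _]] := null_frame_basis oU nf.
by exists U, Y, N, Rt, L; split; split=> //; case: nf.
Qed.

Lemma right_polar_map M y l : right_polar M y l -> polar_map (-1) M y l.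
Proof.
move=> H p /H[U [Y [L [Rt [oU Up UM nf lE]]]]].
have [N [_ fR]] := null_frame_basis oU nf.
by exists U, Y, N, L, Rt; split; split=> //; case: nf.
Qed.

Lemma polar_frame_sub (s : R) U V Y N r X : V `<=` U -> polar_frame s U Y N r X ->
  polar_frame s V Y N r X.
Proof.
move=> VU [sr sX H]; split; [exact: smooth_sub sr|exact: smooth_sub sX|].
by move=> p /VU/H.
Qed.

(** A prescribed lift [X] of the polar surface is c X0 with c = - <X, r>, where X0 is the vector of
    the given frame. Dividing [r] by c restores the product -1 and preserves the determinant, so [X]
    itself becomes a frame vector. *)
Lemma polar_map_adapted (s : R) M y l V X p : polar_map s M y l -> open V -> V `<=` M ->
  local_lift V l X -> V p -> exists U Y N r,
  [/\ open U, U p & U `<=` V] /\ canonical_lift U y Y /\ polar_frame s U Y N r X.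
Proof.
move=> pol oV VM lX Vp; have [U [Y [N [r [X0 [[oU Up UM] [cY fr lE]]]]]]] := pol p (VM _ Vp).
have oW := openI oU oV.
exists (U `&` V), Y, N, (fun q => (- form42 (X q) (r q))^-1 *: r q).
have WU : U `&` V `<=` U by move=> q [].
have WV : U `&` V `<=` V by move=> q [].
split; first by split.
split; first exact: canonical_lift_sub cY.
have [sr sX0 H] := fr.
have sr' := smooth_sub WU sr; have sX' := smooth_sub WV lX.1.
have XE q : (U `&` V) q -> - form42 (X q) (r q) != 0 /\
    X q = (- form42 (X q) (r q)) *: X0 q.
  move=> [Uq Vq]; have [_ HX] := lX; have [Xq0 _ Xl] := HX q Vq.
  have [c c0 XcE] : exists2 c, c != 0 & X q = c *: X0 q.
    by apply: qproj_eqP => //; rewrite Xl lE.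
  have -> : - form42 (X q) (r q) = c.
    rewrite XcE form42Zl (form42C (X0 q)) (pb_rl (H q Uq)); ring.
  by split.
split; [|exact: sX'|].
  apply: (smooth_scale oW _ sr'); apply: (smoothV oW) => [q Wq|].
    by have [] := XE q Wq.
  by apply: (smoothN oW); exact: smooth_form oW sX' sr'.
move=> q Wq; have [c0 E] := XE q Wq; have [Uq Vq] := Wq.
rewrite /polar_basis_at [X in polar_basis _ _ _ _ _ _ _ X]E.
exact: pb_scale c0 (H q Uq).
Qed.

Lemma pb_expand_tangent (s : R) (x xu xv d n r l w : 'rV[R]_6) (e1 e2 : R) :
  polar_basis s x xu xv d n r l ->
  form42 w x = 0 -> form42 w l = 0 -> form42 w xu = e1 -> form42 w xv = e2 ->
  w = (- form42 w r) *: l + (- form42 w n) *: x + (e1 *: xu + e2 *: xv).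
Proof.
move=> B wx wl wu wv; rewrite {1}(pb_expand w B) wx wl wu wv.
by apply/rowP => i; rewrite !mxE; ring.
Qed.

(** * First derivatives of a lift of a polar surface *)

Section PolarDerivative.
Variables (s : R) (U : set (plane R)) (y : plane R -> {vspace 'rV[R]_6}).
Variables (X Y N r : plane R -> 'rV[R]_6).
Hypotheses (oU : open U) (cY : canonical_lift U y Y) (fr : polar_frame s U Y N r X).
Hypothesis uvY : forall p, U p -> exists sigma : R, pu (pv Y) p = sigma *: Y p.

Let sY : smooth_on U Y. Proof. exact: cY.1.1. Qed.
Let sX : smooth_on U X. Proof. by case: fr. Qed.

Lemma polar_tangent b p : U p -> form42 (X p) (pd b Y p) = 0.
Proof. by have [_ _ H] := fr; move=> /H B; case: b; [exact: pb_lv B | exact: pb_lu B]. Qed.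

Lemma polar_second a b p : U p ->
  form42 (pd a X p) (pd b Y p) = - form42 (X p) (pd a (pd b Y) p).
Proof.
move=> Up; apply/eqP; rewrite -addr_eq0 -(pd_form a sX (smooth_pd b sY) Up); apply/eqP.
by apply: (pd_cst a oU Up) => q Uq; exact: polar_tangent.
Qed.

Lemma polar_mixed p : U p -> form42 (X p) (pu (pv Y) p) = 0.
Proof.
move=> Up; have [sigma ->] := uvY Up; have [_ _ H] := fr.
by rewrite form42Zr (pb_lx (H p Up)) mulr0.
Qed.

Lemma polar_second_diag b p : U p ->
  form42 (X p) (pd b (pd b Y) p) = - (sg R b * form42 (pu X p) (pu Y p)).
Proof.
move=> Up; have [_ _ H] := fr; have := pb_ld (H p Up); rewrite form42Dr.
rewrite [form42 (pu X p) _](polar_second false false Up) /=.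
have -> : pd b (pd b Y) p = if b then pv (pv Y) p else pu (pu Y) p by case: b.
move: (pu (pu Y) p) (pv (pv Y) p) => d1 d2 d12.
by case: b; rewrite /sg ?expr0 ?expr1; lra.
Qed.

(** Up to sign this is the second fundamental form of [Y] in the direction [X]: traceless because
    [X] is orthogonal to Y_uu + Y_vv, diagonal because Y_uv is a multiple of [Y]. *)
Lemma polar_cross a b p : U p ->
  form42 (pd a X p) (pd b Y p) = (sg R b * form42 (pu X p) (pu Y p)) *+ (a == b).
Proof.
move=> Up; rewrite polar_second //.
have [->|ab] := eqVneq a b; first by rewrite polar_second_diag // opprK.
rewrite mulr0n; have E := polar_mixed Up.
by case: a b ab => -[] //= _; rewrite -?(pd_comm oU Up sY) E oppr0.
Qed.

Lemma polar_normal b p : U p -> form42 (pd b X p) (Y p) = 0 /\ form42 (pd b X p) (X p) = 0.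
Proof.
move=> Up; have [_ _ H] := fr; split.
  have : pd b (fun q => form42 (X q) (Y q)) p = 0.
    by apply: (pd_cst b oU Up) => q Uq; exact: pb_lx (H q Uq).
  by rewrite (pd_form b sX sY Up) (polar_tangent b Up) addr0.
have : pd b (fun q => form42 (X q) (X q)) p = 0.
  by apply: (pd_cst b oU Up) => q Uq; exact: pb_ll (H q Uq).
rewrite (pd_form b sX sX Up) (form42C (X p)); move: (form42 _ _) => k h; lra.
Qed.

(** The derivative is orthogonal to [X] and [Y], so its components along their duals [r] and [N]
    vanish; [polar_cross] gives the tangential ones. *)
Lemma polar_derivative b p : U p -> pd b X p =
  (- form42 (pd b X p) (r p)) *: X p + (- form42 (pd b X p) (N p)) *: Y p +
  (sg R b * form42 (pu X p) (pu Y p)) *: pd b Y p.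
Proof.
move=> Up; have [_ _ H] := fr; have [XbY XbX] := polar_normal b Up.
have Eu := polar_cross b false Up; have Ev := polar_cross b true Up.
rewrite {1}(pb_expand_tangent (H p Up) XbY XbX Eu Ev); congr (_ + _ + _).
by case: b {XbY XbX Eu Ev}; rewrite /= ?mulr0n ?mulr1n ?scale0r ?addr0 ?add0r.
Qed.

(** Modulo [X] and [Y], both orthogonal to X_a, the derivative X_b is a multiple of Y_b, and the
    products of X_a with Y_b are given by [polar_cross]. *)
Lemma polar_metric a b p : U p ->
  form42 (pd a X p) (pd b X p) = form42 (pu X p) (pu Y p) ^+ 2 *+ (a == b).
Proof.
move=> Up; have [XaY XaX] := polar_normal a Up.
rewrite (polar_derivative b Up) !(form42Dr _ _ (pd a X p)) !form42Zr XaY XaX polar_cross //.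
have sg2 : sg R b * sg R b = 1 by rewrite /sg -expr2 sqrr_sign.
case: (a == b); rewrite ?mulr1n ?mulr0n; last ring.
transitivity (sg R b * sg R b * form42 (pu X p) (pu Y p) ^+ 2); first ring.
by rewrite sg2 mul1r.
Qed.
End PolarDerivative.
End Polar.

(** * Conformality of polar surfaces and the pair equation for a canonical lift *)

Section Conformal.
Variable R : realType.
Implicit Types (U V M : set (plane R)) (y l : plane R -> {vspace 'rV[R]_6})
  (X Y N r : plane R -> 'rV[R]_6).

(* If Xu and Xv both lay in Span(X, Y), a combination of them would be
   proportional to X. *)
Lemma immersion_not_in_plane M l V X p (Yp : 'rV[R]_6) (au av bu bv : R) :
  immersion M l -> open V -> V `<=` M -> local_lift V l X -> V p ->
  pu X p = au *: X p + bu *: Yp -> pv X p = av *: X p + bv *: Yp -> False.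
Proof.
move=> [_ imm] oV VM lX Vp Xu Xv.
have H (w1 w2 : R) : w1 * bu + w2 * bv = 0 -> w1 = 0 /\ w2 = 0.
  move=> w0; have [] : ((w1, w2) : plane R) = 0; last by [].
  apply: (imm V X oV VM lX p _ Vp); rewrite dmapE /= Xu Xv; apply/vlineP.
  exists (w1 * au + w2 * av); rewrite -[RHS]addr0 -[in RHS](scale0r Yp) -w0.
  by apply/rowP => i; rewrite !mxE; ring.
have bu0 : bu = 0 by have [_ h] := H bv (- bu) (ltac:(ring)); lra.
have [h _] := H 1 0 (ltac:(rewrite bu0; ring)).
by move/eqP: h; rewrite oner_eq0.
Qed.

(** Were this product zero, [polar_derivative] would put both X_u and X_v in the plane of [X] and
    [Y]. *)
Lemma polar_nondegenerate (s : R) M y l U X Y N r p :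
  conjugate_lines M y -> immersion M l -> open U -> U `<=` M -> local_lift U l X ->
  canonical_lift U y Y -> polar_frame s U Y N r X -> U p ->
  form42 (pu X p) (pu Y p) != 0.
Proof.
move=> cl imm oU UM lX cY fr Up; have uvY := cl U Y oU UM cY.
apply/eqP => f0.
have drop (k f : R) (w a c : 'rV[R]_6) : f = 0 -> w = a + (k * f) *: c -> w = a.
  by move=> -> ->; rewrite mulr0 scale0r addr0.
have Xu := drop _ _ _ _ _ f0 (polar_derivative oU cY fr uvY false Up).
have Xv := drop _ _ _ _ _ f0 (polar_derivative oU cY fr uvY true Up).
exact: immersion_not_in_plane imm oU UM lX Up Xu Xv.
Qed.

Lemma polar_map_metric (s : R) M y l V X p : polar_map s M y l -> conjugate_lines M y ->
  immersion M l -> open V -> V `<=` M -> local_lift V l X -> V p ->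
  exists2 f : R, f != 0 &
    [/\ form42 (pu X p) (pu X p) = f ^+ 2, form42 (pv X p) (pv X p) = f ^+ 2
      & form42 (pu X p) (pv X p) = 0].
Proof.
move=> pol cl imm oV VM lX Vp.
have [U [Y [N [r [[oU Up UV] [cY fr]]]]]] := polar_map_adapted pol oV VM lX Vp.
have UM := subset_trans UV VM; have uvY := cl U Y oU UM cY.
exists (form42 (pu X p) (pu Y p)).
  exact: polar_nondegenerate cl imm oU UM (local_lift_sub UV lX) cY fr Up.
split.
- exact: (polar_metric oU cY fr uvY false false Up).
- exact: (polar_metric oU cY fr uvY true true Up).
- exact: (polar_metric oU cY fr uvY false true Up).
Qed.

Lemma polar_map_conformal (s : R) M y l : polar_map s M y l -> conjugate_lines M y ->
  immersion M l -> conformal_spacelike M l.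
Proof.
move=> pol cl imm; split=> // V X oV VM lX p Vp.
have [f f0 [uu vv uv]] := polar_map_metric pol cl imm oV VM lX Vp.
have [-> ->] := form_Yz_conformal uu vv uv; split=> //.
by rewrite ltcR divr_gt0 // exprn_even_gt0.
Qed.

Lemma polar_map_spacelike (s : R) M y l : polar_map s M y l -> conjugate_lines M y ->
  immersion M l -> spacelike_immersion M l.
Proof.
move=> pol cl imm; split=> // V X oV VM lX p [w1 w2] Vp w0.
have [f f0 [uu vv uv]] := polar_map_metric pol cl imm oV VM lX Vp.
rewrite dmapE; move: (pu X p) (pv X p) uu vv uv => a b uu vv uv.
rewrite form_lincomb uu vv uv mulr0 addr0 -mulrDl -!expr2 /=.
have f2 : 0 < f ^+ 2 by rewrite exprn_even_gt0.
apply: mulr_gt0 => //; rewrite lt0r addr_ge0 ?sqr_ge0 // andbT.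
apply/negP => /eqP E; apply: w0.
have w10 : w1 = 0.
  by apply/eqP; rewrite -sqrf_eq0 eq_le sqr_ge0 andbT -E lerDl sqr_ge0.
have w20 : w2 = 0.
  by apply/eqP; rewrite -sqrf_eq0 eq_le sqr_ge0 andbT -E lerDr sqr_ge0.
by rewrite w10 w20.
Qed.

(* Pairing the integrability condition X_uv = X_vu with Y_u and Y_v. *)
Lemma polar_canonical_coef (s : R) U y X Y N r b p : open U -> canonical_lift U y Y ->
  polar_frame s U Y N r X ->
  (forall p, U p -> exists sigma : R, pu (pv Y) p = sigma *: Y p) ->
  (forall q, U q -> form42 (pu X q) (pu Y q) = form42 (pu X p) (pu Y p)) -> U p ->
  form42 (pu X p) (pu Y p) ^+ 2 = 1 ->
  - form42 (pd b X p) (N p) =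
    - form42 (pd b X p) (r p) * (sg R b * form42 (pu X p) (pu Y p)).
Proof.
move=> oU cY fr uvY fc Up f1; set f := form42 (pu X p) (pu Y p).
have sY := cY.1.1; have [_ sX H] := fr; have Bp := H p Up.
have [sigma uvE] := uvY p Up.
have mix a : pd a (pd (~~ a) Y) p = sigma *: Y p.
  by case: a => /=; rewrite -?(pd_comm oU Up sY).
have dX c : form42 (pd c X p) (Y p) = 0 by have [] := polar_normal oU cY fr c Up.
have tanY c : form42 (Y p) (pd c Y p) = 0 by exact: local_lift_tangent oU cY.1 Up.
(* The other coordinate direction. As <X_c, Y_c> is constant and Y_bc is a multiple of [Y],
   differentiation along b gives E1; differentiating <X_b, Y_c> = 0 along c then gives E2. *)
pose c := ~~ b.
have E1 : form42 (pd c (pd b X) p) (pd c Y p) = 0.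
  have -> : pd c (pd b X) p = pd b (pd c X) p.
    by rewrite /c; case: (b) => /=; rewrite (pd_comm oU Up sX).
  have : pd b (fun q => form42 (pd c X q) (pd c Y q)) p = 0.
    apply: (pd_cst b oU Up (a := sg R c * f)) => q Uq.
    by rewrite (polar_cross oU cY fr uvY c c Uq) eqxx mulr1n fc.
  rewrite (pd_form b (smooth_pd c sX) (smooth_pd c sY) Up) mix form42Zr dX.
  by rewrite mulr0 addr0.
have E2 : form42 (pd b X p) (pd c (pd c Y) p) = 0.
  have : pd c (fun q => form42 (pd b X q) (pd c Y q)) p = 0.
    apply: (pd_cst c oU Up (a := 0)) => q Uq.
    by rewrite (polar_cross oU cY fr uvY b c Uq) /c; case: (b).
  by rewrite (pd_form c (smooth_pd b sX) (smooth_pd c sY) Up) E1 add0r.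
have E3 : form42 (pd b Y p) (pd c (pd c Y) p) = 0.
  have := canonical_lift_metric_derive b c c oU cY Up.
  have -> : pd c (pd b Y) p = sigma *: Y p by rewrite -(mix c) /c negbK.
  by rewrite form42Zl tanY mulr0 add0r.
have E4 := polar_second_diag oU cY fr c Up.
have E5 : form42 (Y p) (pd c (pd c Y) p) = -1.
  by rewrite (canonical_lift_second c c oU cY Up) eqxx.
have E6 : sg R c = - sg R b by rewrite /c /sg; case: (b); rewrite /= ?opprK.
(* With X_b expanded in [X], [Y] and Y_b, E2 becomes a linear relation between the coefficients [k1]
   of [X] and [k2] of [Y], since Y_b is orthogonal to Y_cc. *)
move: E2; rewrite {1}(polar_derivative oU cY fr uvY b Up) !form42Dl !form42Zl E3 E4 E5 E6.
rewrite -/f; set k1 := - form42 _ _; set k2 := - form42 _ _ => /eqP E.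
apply/eqP; rewrite -subr_eq0 -oppr_eq0; apply/eqP; rewrite -(eqP E); ring.
Qed.

(** A canonical [X] has f^2 = 1 by [polar_metric]; shrinking to a set where f is constant lets
    [polar_canonical_coef] combine the [X] and [Y] terms. *)
Lemma polar_map_line_pair (s : R) M y l V X p : polar_map s M y l -> conjugate_lines M y ->
  open V -> V `<=` M -> canonical_lift V l X -> V p -> exists W Y N r f m,
  [/\ open W, W p & W `<=` V] /\
  [/\ canonical_lift W y Y, polar_frame s W Y N r X, f ^+ 2 = 1,
      forall b, smooth_on W (m b) & line_pair W f X Y m] /\
  forall q, W q -> form42 (pu X q) (pu Y q) = f.
Proof.
move=> pol cl oV VM cX Vp.
have [U [Y [N [r [[oU Up UV] [cY fr]]]]]] := polar_map_adapted pol oV VM cX.1 Vp.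
have UM := subset_trans UV VM; have uvY := cl U Y oU UM cY.
have sY := cY.1.1; have [sr sX H] := fr.
have sf : smooth_on U (fun q => form42 (pu X q) (pu Y q)).
  by apply: smooth_form oU _ _; exact: smooth_pu.
have f1 q : U q -> form42 (pu X q) (pu Y q) ^+ 2 = 1.
  move=> Uq; have := polar_metric oU cY fr uvY false false Uq.
  by rewrite (canonical_lift_metric false false cX (UV _ Uq)) eqxx.
have [W [oW Wp WU Wf]] := locally_constant_of_sqr oU Up sf (oner_neq0 R) f1.
have cYW := canonical_lift_sub WU cY; have frW := polar_frame_sub WU fr.
exists W, Y, N, r, (form42 (pu X p) (pu Y p)), (fun b q => - form42 (pd b X q) (r q)).
split; first by split=> //; exact: subset_trans WU UV.
split; last exact: Wf.
have sXW := smooth_sub WU sX; have srW := smooth_sub WU sr.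
split=> //; first exact: f1.
  move=> b; apply: (smoothN oW); exact: smooth_form oW (smooth_pd b sXW) srW.
move=> b q Wq; have Uq := WU _ Wq.
have uvYW q' : W q' -> exists sigma : R, pu (pv Y) q' = sigma *: Y q'.
  by move=> /WU; exact: uvY.
have := polar_canonical_coef b oW cYW frW uvYW _ Wq (f1 _ Uq).
rewrite (Wf _ Wq) => /(_ Wf) coef.
rewrite {1}(polar_derivative oW cYW frW uvYW b Wq) coef (Wf _ Wq).
move: (- form42 _ _) (sg R b * _) => k1 k2.
by rewrite scalerDr scalerA.
Qed.
End Conformal.

(** * The transform of a polar surface *)

Section Transform.
Variable R : realType.
Implicit Types (U V M : set (plane R)) (y l : plane R -> {vspace 'rV[R]_6})
  (X Y Z N r : plane R -> 'rV[R]_6).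

(** * The normalized lift of a transform and its canonical lifts *)

Section NormalizedLift.
Variables (U : set (plane R)) (y ystar : plane R -> {vspace 'rV[R]_6}).
Variables (Y Ys : plane R -> 'rV[R]_6) (theta : R) (m : bool -> plane R -> R).
Hypotheses (oU : open U) (cY : canonical_lift U y Y) (lYs : local_lift U ystar Ys).
Hypothesis norm : forall p, U p -> form42 (Y p) (Ys p) = -1.
Hypothesis pr : line_pair U theta Ys Y m.

Let sY : smooth_on U Y. Proof. exact: cY.1.1. Qed.
Let sYs : smooth_on U Ys. Proof. exact: lYs.1. Qed.

(** Differentiating <Y, Ys> = -1 shows that the coefficient [m] is determined by the two lifts,
    which later gives its derivative in terms of theirs. *)
Lemma normalized_lift_tangent b p : U p -> form42 (pd b Y p) (Ys p) = m b p.
Proof.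
move=> Up.
have : pd b (fun q => form42 (Y q) (Ys q)) p = 0 by exact: (pd_cst b oU Up norm).
rewrite (pd_form b sY sYs Up) (pr b Up).
have := local_lift_tangent b oU cY.1 Up; have := local_lift_null cY.1 Up.
have := norm Up; move: (pd b Y p) (Y p) (Ys p) => yb y0 ys yys y0y0 y0yb.
by rewrite !form42Dr !form42Zr form42Dr form42Zr yys y0y0 y0yb => E; lra.
Qed.

Lemma normalized_lift_metric b p : U p -> form42 (pd b Ys p) (pd b Ys p) = theta ^+ 2.
Proof.
move=> Up; rewrite (pr b Up).
have := local_lift_tangent b oU cY.1 Up; have := local_lift_null cY.1 Up.
have := canonical_lift_metric b b cY Up; rewrite eqxx.
have := normalized_lift_tangent b Up; have := local_lift_null lYs Up.
have := norm Up; move: (pd b Y p) (Y p) (Ys p) (m b p) => yb y0 ys k yys ysys ybys ybyb y0y0 y0yb.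
rewrite !(form42Dl, form42Zl) !(form42Dr, form42Zr).
rewrite yys ysys ybys ybyb y0y0 y0yb (form42C ys y0) (form42C yb y0) (form42C ys yb) yys ybys y0yb.
transitivity ((sg R b * sg R b) * theta ^+ 2); last by rewrite sg_sqr mul1r.
by rewrite mulr1n; ring.
Qed.

Lemma normalized_lift_independent p (a b : R) : U p -> a *: Ys p + b *: Y p = 0 -> a = 0 /\ b = 0.
Proof.
move=> Up E; have yys := norm Up.
have := congr1 (form42 (Y p)) E; have := congr1 (form42 (Ys p)) E.
rewrite !form42Dr !form42Zr !form420r (form42C (Ys p) (Y p)) yys.
by rewrite (local_lift_null lYs Up) (local_lift_null cY.1 Up) => h1 h2; split; lra.
Qed.

(** The normalized lift induces theta^2 |dz|^2, so the factor - <Y, Z> relating it to a canonical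
    lift has constant square and is locally constant. *)
Lemma canonical_lift_multiple Z p : canonical_lift U ystar Z -> theta != 0 -> U p ->
  exists W (c : R), [/\ open W, W p, W `<=` U, c ^+ 2 * theta ^+ 2 = 1
    & forall q, W q -> Z q = c *: Ys q].
Proof.
move=> cZ t0 Up; have sZ := cZ.1.1.
pose c q := - form42 (Y q) (Z q).
have sc : smooth_on U c by apply: (smoothN oU); exact: smooth_form.
have ZE q : U q -> Z q = c q *: Ys q.
  move=> Uq; have [_ /(_ q Uq)[Z0 _ Zl]] := cZ.1.
  have [_ /(_ q Uq)[_ _ Ysl]] := lYs.
  have [k _ E] : exists2 k, k != 0 & Z q = k *: Ys q by apply: qproj_eqP; rewrite // Zl Ysl.
  by rewrite /c E form42Zr (norm Uq) mulrN1 opprK.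
have c2 q : U q -> c q ^+ 2 * theta ^+ 2 = 1.
  move=> Uq.
  have E : form42 (pd false Z q) (pd false Z q) = 1 := canonical_lift_metric false false cZ Uq.
  rewrite -E (pd_eq false oU Uq ZE) (pd_scale false sc sYs Uq) form_lincomb.
  rewrite (local_lift_null lYs Uq) (local_lift_tangent false oU lYs Uq).
  rewrite (normalized_lift_metric false Uq); ring.
have c2' q : U q -> c q ^+ 2 = (theta ^+ 2)^-1.
  by move=> Uq; apply: (mulIf (expf_neq0 2 t0)); rewrite c2 // mulVf ?expf_neq0.
have [|W [oW Wp WU Wc]] := locally_constant_of_sqr oU Up sc _ c2'.
  by rewrite invr_eq0 expf_neq0.
exists W, (c p); split=> //; first exact: c2.
by move=> q Wq; rewrite -(Wc q Wq); exact: ZE (WU _ Wq).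
Qed.
End NormalizedLift.

Lemma pd_multiple b W X Z (c : R) p : open W -> smooth_on W X -> W p ->
  (forall q, W q -> Z q = c *: X q) -> pd b Z p = c *: pd b X p.
Proof.
by move=> oW sX Wp ZE; rewrite (pd_eq b oW Wp ZE) (pdZ b c sX Wp).
Qed.

Lemma pd2_multiple a b W X Z (c : R) p : open W -> smooth_on W X -> W p ->
  (forall q, W q -> Z q = c *: X q) -> pd a (pd b Z) p = c *: pd a (pd b X) p.
Proof.
move=> oW sX Wp ZE; apply: (pd_multiple _ oW (smooth_pd b sX) Wp) => q Wq.
exact: pd_multiple oW sX Wq ZE.
Qed.

Lemma Dtheta_conjugate_lines (s : R) M theta y ystar l : theta != 0 ->
  Dtheta_transform M theta y ystar -> polar_map s M y l -> conjugate_lines M y ->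
  conjugate_lines M ystar.
Proof.
move=> t0 Dth pol cl V Z oV VM cZ p Vp.
(* The polar frame is used only for the canonical lift of [y] that it contains. *)
have [U [Y [_ [_ [_ [[oU Up UM] [cY _ _]]]]]]] := pol p (VM _ Vp).
have oW := openI oU oV.
have WU : U `&` V `<=` U by move=> q [].
have WV : U `&` V `<=` V by move=> q [].
have cYW := canonical_lift_sub WU cY; have cZW := canonical_lift_sub WV cZ.
have WM := subset_trans WU UM.
have [Ys [m [lYs norm sm pr]]] := Dtheta_pair Dth oW WM cYW.
have [W' [c [oW' W'p W'W _ ZE]]] :=
  canonical_lift_multiple oW cYW lYs norm pr cZW t0 (conj Up Vp).
have [sigma Yuv] := cl _ Y oW WM cYW p (conj Up Vp).
have indep := fun a b => normalized_lift_independent cYW lYs norm (conj Up Vp) (a := a) (b := b).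
have [tau Ysuv] := line_pair_conjugate oW lYs.1 cYW.1.1 sm pr (conj Up Vp) t0 indep Yuv.
exists tau.
rewrite [LHS](pd2_multiple false true oW' (smooth_sub W'W lYs.1) W'p ZE) /= Ysuv.
by rewrite (ZE p W'p) !scalerA mulrC.
Qed.
End Transform.

(** * Isothermicity of polar surfaces *)

Section PolarIsothermic.
Local Open Scope complex_scope.
Variable R : realType.
Implicit Types (U V M : set (plane R)) (y l : plane R -> {vspace 'rV[R]_6})
  (X Y Z N r : plane R -> 'rV[R]_6).

Lemma polar_basis_independent (s : R) (x xu xv d n r l : 'rV[R]_6) (a b : R) :
  polar_basis s x xu xv d n r l -> a *: l + b *: x = 0 -> a = 0 /\ b = 0.
Proof.
move=> B E; have := congr1 (form42 r) E; have := congr1 (form42 n) E.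
rewrite !form42Dr !form42Zr !form420r (pb_rl B) (pb_rx B) (pb_nx B) (form42C n l) (pb_ln B).
by move=> h1 h2; split; lra.
Qed.

Lemma polar_map_conjugate_lines (s : R) M y l : polar_map s M y l -> conjugate_lines M y ->
  conjugate_lines M l.
Proof.
move=> pol cl V X oV VM cX p Vp.
have [W [Y [N [r [f [m [[oW Wp WV] [[cY fr f1 sm pr] _]]]]]]]] :=
  polar_map_line_pair pol cl oV VM cX Vp.
have [sr sX H] := fr.
have [sigma Yuv] := cl W Y oW (subset_trans WV VM) cY p Wp.
have f0 : f != 0 by apply/eqP => f0; move: f1; rewrite f0 expr0n => /eqP; rewrite eq_sym oner_eq0.
apply: (line_pair_conjugate oW sX cY.1.1 sm pr Wp f0 _ Yuv) => a b.
exact: polar_basis_independent (H p Wp).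
Qed.

Lemma neq_of_opposite (f e1 e2 : R) : f ^+ 2 = 1 ->
  e1 = - (sg R false * f) -> e2 = - (sg R true * f) -> e1 != e2.
Proof.
move=> f1 -> ->; rewrite /sg expr0 expr1; apply/eqP => h; have f0 : f = 0 by lra.
by move: f1; rewrite f0 expr0n => /eqP; rewrite eq_sym oner_eq0.
Qed.

(** Modulo [X] the Hopf differential is (X_uu - X_vv) / 4, so a vector orthogonal to [X] that
    separates X_uu from X_vv excludes umbilics. [Y] does so: its products with them are - f and
    f. *)
Lemma polar_map_non_umbilic (s : R) M y l V X p : polar_map s M y l -> conjugate_lines M y ->
  open V -> V `<=` M -> canonical_lift V l X -> V p ->
  exists2 w, form42 (X p) w = 0 & form42 (pu (pu X) p) w != form42 (pv (pv X) p) w.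
Proof.
move=> pol cl oV VM cX Vp.
have [W [Y [N [r [f [m [[oW Wp WV] [[cY fr f1 sm pr] XYf]]]]]]]] :=
  polar_map_line_pair pol cl oV VM cX Vp.
have [sr sX H] := fr; have uvY := cl W Y oW (subset_trans WV VM) cY.
exists (Y p); first exact: pb_lx (H p Wp).
have E b : form42 (pd b (pd b X) p) (Y p) = - (sg R b * f).
  have : pd b (fun q => form42 (pd b X q) (Y q)) p = 0.
    apply: (pd_cst b oW Wp (a := 0)) => q Wq.
    by have [] := polar_normal oW cY fr b Wq.
  rewrite (pd_form b (smooth_pd b sX) cY.1.1 Wp).
  rewrite (polar_cross oW cY fr uvY b b Wp) eqxx mulr1n (XYf p Wp) => /eqP.
  by rewrite addr_eq0 => /eqP.
have Eu : form42 (pu (pu X) p) (Y p) = - (sg R false * f) := E false.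
have Ev : form42 (pv (pv X) p) (Y p) = - (sg R true * f) := E true.
exact: neq_of_opposite f1 Eu Ev.
Qed.

(** The candidate for [kappa]: [dm / 4] is already orthogonal to [x], [xu], [xv], and the multiple
    of [x] is adjusted through <x, d1 + d2> = -2 to make it orthogonal to [d1 + d2]. *)
Lemma hopf_normal (x xu xv d1 d2 : 'rV[R]_6) :
  form42 x x = 0 -> form42 x xu = 0 -> form42 x xv = 0 ->
  form42 x d1 = -1 -> form42 x d2 = -1 ->
  form42 d1 xu = 0 -> form42 d2 xu = 0 -> form42 d1 xv = 0 -> form42 d2 xv = 0 ->
  let dm := d1 + (-1) *: d2 in
  let k := 4^-1 *: dm + (2^-1 * (4^-1 * form42 dm (d1 + d2))) *: x in
  [/\ form42 k x = 0, form42 k xu = 0, form42 k xv = 0 & form42 k (d1 + d2) = 0].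
Proof.
move=> xx xu0 xv0 xd1 xd2 d1u d2u d1v d2v dm k.
have dx : form42 x (d1 + d2) = -2 by rewrite form42Dr xd1 xd2; lra.
have dmx : form42 dm x = 0 by rewrite form42Dl form42Zl !(form42C _ x) xd1 xd2; lra.
have dmu : form42 dm xu = 0 by rewrite form42Dl form42Zl d1u d2u; ring.
have dmv : form42 dm xv = 0 by rewrite form42Dl form42Zl d1v d2v; ring.
by split; rewrite form42Dl !form42Zl ?dmx ?dmu ?dmv ?xx ?xu0 ?xv0 ?dx; field.
Qed.

Section Hopf.
Variables (V : set (plane R)) (l : plane R -> {vspace 'rV[R]_6}) (X : plane R -> 'rV[R]_6).
Hypotheses (oV : open V) (cX : canonical_lift V l X).
Hypothesis uvX : forall p, V p -> exists tau : R, pu (pv X) p = tau *: X p.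
Hypothesis nuX : forall p, V p ->
  exists2 w, form42 (X p) w = 0 & form42 (pu (pu X) p) w != form42 (pv (pv X) p) w.

Let sX : smooth_on V X. Proof. exact: cX.1.1. Qed.
Let Dm q := pu (pu X) q + (-1) *: pv (pv X) q.
Let Dp q := pu (pu X) q + pv (pv X) q.
(** [re] and [im] are the real and imaginary parts of the function s. Since <X, Dp> = -2, [im] is
    the factor of X in X_uv; written as a product of derivatives it is visibly smooth. *)
Let re q := 4^-1 * form42 (Dm q) (Dp q).
Let im q := - 2^-1 * form42 (pu (pv X) q) (Dp q).
Let k q := 4^-1 *: Dm q + (2^-1 * re q) *: X q.

Let second_diag b p : V p -> form42 (X p) (pd b (pd b X) p) = -1.
Proof. by move=> Vp; rewrite (canonical_lift_second b b oV cX Vp) eqxx. Qed.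

(** The metric |dz|^2 has constant coefficients, so its Christoffel symbols vanish. *)
Let second_tangent b c p : V p -> form42 (pd c (pd c X) p) (pd b X p) = 0.
Proof.
move=> Vp; have := canonical_lift_metric_derive c b c oV cX Vp.
have [->|bc] := eqVneq b c.
  by move: (pd c (pd c X) p) (pd c X p) => x1 x2; rewrite (form42C x2) => h; lra.
have := canonical_lift_metric_derive c c b oV cX Vp.
have -> : pd b (pd c X) p = pd c (pd b X) p.
  exact: pd_pdC oV Vp sX.
move: (pd c (pd c X) p) (pd b X p) (pd c X p) (pd c (pd b X) p) => x1 x2 x3 x4.
by rewrite (form42C x4 x3) => h1 h2; lra.
Qed.

Let k_normal p : V p -> normal_vec X p (k p).
Proof.
move=> Vp w.
have [kx ku kv kd] := hopf_normal (local_lift_null cX.1 Vp)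
  (local_lift_tangent false oV cX.1 Vp) (local_lift_tangent true oV cX.1 Vp)
  (second_diag false Vp) (second_diag true Vp)
  (second_tangent false false Vp) (second_tangent false true Vp)
  (second_tangent true false Vp) (second_tangent true true Vp).
exact: (Vbundle_perp sX Vp kx ku kv kd).
Qed.

Let im_eq p : V p -> pu (pv X) p = im p *: X p.
Proof.
move=> Vp; have [tau E] := uvX Vp; rewrite /im E form42Zl.
have aux (x d1 d2 : 'rV[R]_6) : form42 x d1 = -1 -> form42 x d2 = -1 ->
    tau = - 2^-1 * (tau * form42 x (d1 + d2)).
  by move=> h1 h2; rewrite form42Dr h1 h2; lra.
congr (_ *: _); exact: aux (second_diag false Vp) (second_diag true Vp).
Qed.

Let sDm : smooth_on V Dm.
Proof.
exact: (smoothD oV (smooth_pu (smooth_pu sX)) (smoothZ _ oV (smooth_pv (smooth_pv sX)))).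
Qed.

Let sDp : smooth_on V Dp.
Proof. exact: (smoothD oV (smooth_pu (smooth_pu sX)) (smooth_pv (smooth_pv sX))). Qed.

Let sre : smooth_on V re.
Proof. by apply: (smoothM oV); [exact: smooth_cst | exact: smooth_form]. Qed.

Lemma canonical_hopf : exists (s : plane R -> R[i]) (kappa : plane R -> 'rV[R[i]]_6),
  hopf_differential V X s kappa /\
  forall p, V p -> kappa p <> 0 /\ conjV (kappa p) = kappa p.
Proof.
exists (fun p => (re p +i* im p)%C), (fun p => cplx (k p)); split; last first.
  move=> p Vp; split; last first.
    by apply: cvec_eq; rewrite ?reV_conj ?imV_conj // imV_cplx oppr0.
  move/(congr1 (@reV R)); rewrite reV_cplx => k0.
  have [w Xw /eqP[]] := nuX Vp.
  have kw : form42 (k p) w = 0.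
    rewrite k0; have -> : reV (0 : 'rV[R[i]]_6) = 0 by apply/rowP => i; rewrite !mxE.
    exact: form420l.
  have aux (x d1 d2 : 'rV[R]_6) (e : R) : form42 x w = 0 ->
      form42 (4^-1 *: (d1 + (-1) *: d2) + e *: x) w = 0 -> form42 d1 w = form42 d2 w.
    by move=> xw; rewrite form42Dl !form42Zl form42Dl form42Zl xw => h; lra.
  exact: aux Xw kw.
split.
- split; first exact: sre.
  apply: (smoothM oV); first exact: smooth_cst.
  apply: (smooth_form oV _ sDp); exact: smooth_pu (smooth_pv sX).
- split.
    have -> : (fun p => reV (cplx (k p))) = k by apply/funext => p; exact: reV_cplx.
    apply: (smoothD oV); first exact: smoothZ.
    by apply: (smooth_scale oV _ sX); apply: (smoothM oV _ sre); exact: smooth_cst.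
  have -> : (fun p => imV (cplx (k p))) = fun=> 0 by apply/funext => p; exact: imV_cplx.
  exact: smooth_cst.
- move=> p Vp; split; last first.
    by move=> w wV; rewrite form_cplx (k_normal Vp wV).
  have [hr hi] := half_parts (re p +i* im p)%C.
  apply: cvec_eq.
    rewrite (reV_Yzz sX Vp) reVD reVZ !reV_cplx imV_cplx.
    rewrite [complex.Re _](_ : _ = - (re p / 2)); last by rewrite -hr; case: (_ / 2).
    rewrite /k /Dm; move: (pu (pu X) p) (pv (pv X) p) (X p) (re p) => d1 d2 x e.
    by rewrite scaler0 subr0; apply/rowP => i; rewrite !mxE; ring.
  rewrite (imV_Yzz oV sX Vp) imVD imVZ !imV_cplx reV_cplx (im_eq Vp).
  rewrite [complex.Im _](_ : _ = - (im p / 2)); last by rewrite -hi; case: (_ / 2).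
  by move: (X p) (im p) => x e; apply/rowP => i; rewrite !mxE; ring.
Qed.
End Hopf.

Lemma polar_map_isothermic (s : R) M y l : polar_map s M y l -> conjugate_lines M y ->
  immersion M l -> isothermic M l.
Proof.
move=> pol cl imm; split; first exact: polar_map_conformal pol cl imm.
move=> V X oV VM cX; apply: (canonical_hopf oV cX) => p Vp.
  exact: polar_map_conjugate_lines pol cl V X oV VM cX p Vp.
exact: polar_map_non_umbilic pol cl oV VM cX Vp.
Qed.
End PolarIsothermic.

(** * The normalized lift of the transformed polar surface near a point *)

Section PolarTransform.
Variable R : realType.
Implicit Types (U V M : set (plane R)) (y l : plane R -> {vspace 'rV[R]_6})
  (X Y Z N r : plane R -> 'rV[R]_6).

Lemma polar_basis_swap (s : R) (x xu xv d n r l : 'rV[R]_6) :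
  polar_basis s x xu xv d n r l -> polar_basis (- s) x xu xv d n l r.
Proof.
move=> [? ? ? ? ? ? ? ? ? ? ? ? ? ? ? ? ? ? ? ? ? rl o]; split=> //.
  by rewrite form42C.
by rewrite det_rows6_swap34 mulrNN.
Qed.

(** [transformed_polar] compares two null normals; by this exchange the results about [X] apply to
    [r] as well. *)
Lemma polar_frame_swap (s : R) U Y N r X : polar_frame s U Y N r X ->
  polar_frame (- s) U Y N X r.
Proof. by move=> [sr sX H]; split=> // p /H; exact: polar_basis_swap. Qed.

(** The signs cancel in the ratio, so one value of [k] in [adj] serves both coordinate
    directions. *)
Lemma sg_div b (f t : R) : sg R b * f / (sg R b * t) = f / t.
Proof. by rewrite -mulf_div divff ?mul1r // /sg signr_eq0. Qed.

Section Adjusted.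
Variables (s : R) (U : set (plane R)) (y ystar : plane R -> {vspace 'rV[R]_6}).
Variables (X Y N r Ys : plane R -> 'rV[R]_6) (theta : R) (m : bool -> plane R -> R).
Hypotheses (oU : open U) (cY : canonical_lift U y Y) (lYs : local_lift U ystar Ys).
Hypotheses (norm : forall p, U p -> form42 (Y p) (Ys p) = -1) (t0 : theta != 0).
Hypotheses (sm : forall b, smooth_on U (m b)) (pr : line_pair U theta Ys Y m).
Hypotheses (fr : polar_frame s U Y N r X)
  (uvY : forall p, U p -> exists sigma : R, pu (pv Y) p = sigma *: Y p).

Lemma adj_normalized_second b p : U p ->
  form42 (adj (Y p) (Ys p) (- (form42 (pu X p) (pu Y p) / theta)) (X p)) (pd b (pd b Ys) p) =
  - (sg R b * theta * form42 (X p) (Ys p)).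
Proof.
move=> Up; have sY := cY.1.1; have sYs := lYs.1; have [sr sX H] := fr.
have tb0 : sg R b * theta != 0 by rewrite mulf_neq0 // /sg signr_eq0.
have k1E : form42 (pd b Ys p) (pd b Y p) + form42 (Ys p) (pd b (pd b Y) p) = pd b (m b) p.
  have <- : pd b (fun q => form42 (pd b Y q) (Ys q)) p = pd b (m b) p.
    by apply: (pd_eq b oU Up) => q Uq; exact: (normalized_lift_tangent oU cY lYs norm pr b Uq).
  rewrite (pd_form b (smooth_pd b sY) sYs Up).
  move: (pd b Ys p) (pd b Y p) (Ys p) (pd b (pd b Y) p) => x1 x2 x3 x4.
  by rewrite (form42C x1) (form42C x3) addrC.
rewrite (line_pair_second b b oU sYs sY sm pr Up) -(sg_div b).
have uu : form42 (pd b Y p) (pd b Y p) = 1 by rewrite (canonical_lift_metric b b cY Up) eqxx.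
have Yuu : form42 (Y p) (pd b (pd b Y) p) = -1.
  by rewrite (canonical_lift_second b b oU cY Up) eqxx.
have Xu : form42 (X p) (pd b Y p) = 0 by exact: (polar_tangent fr b Up).
exact: (adj_second tb0 (local_lift_null cY.1 Up) (local_lift_tangent b oU cY.1 Up)
  (norm Up) (local_lift_null lYs Up) (normalized_lift_tangent oU cY lYs norm pr b Up)
  (pr b Up) uu Yuu k1E (pb_lx (H p Up)) Xu (polar_second_diag oU cY fr b Up)).
Qed.

Lemma adj_normalized_laplace p : U p ->
  form42 (adj (Y p) (Ys p) (- (form42 (pu X p) (pu Y p) / theta)) (X p))
    (pu (pu Ys) p + pv (pv Ys) p) = 0.
Proof.
move=> Up; rewrite form42Dr.
have aux (e1 e2 g : R) : e1 = - (sg R false * theta * g) -> e2 = - (sg R true * theta * g) ->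
    e1 + e2 = 0 by move=> -> ->; rewrite /sg expr0 expr1; ring.
exact: aux (adj_normalized_second false Up) (adj_normalized_second true Up).
Qed.
End Adjusted.

(** Here [F] and [t] are f and theta with the sign of the direction, and [hb] is the derivative of 1
    / g, known through that of g g^-1 = 1. The identity holds only modulo F^2 = 1, hence the split
    into F = 1 and F = -1. *)
Lemma line_pair_transform_alg (x xb y0 yb ys ysb : 'rV[R]_6) (F t g a m hb : R) :
  F ^+ 2 = 1 -> g != 0 ->
  xb = a *: (x + F *: y0) + F *: yb -> ysb = m *: (ys + t *: y0) + t *: yb ->
  (a * (g - F) + m * (F + g)) * g^-1 + g * hb = 0 ->
  hb *: ((F * t) *: x + (-1) *: ys) + g^-1 *: ((F * t) *: xb + (-1) *: ysb) + (F * t) *: yb =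
  ((a * (F - g) - m * F) / g) *:
    (g^-1 *: ((F * t) *: x + (-1) *: ys) + (F * t) *: y0 + t *: x) + t *: xb.
Proof.
move=> F1 g0 -> -> hbE.
have -> : hb = - ((a * (g - F) + m * (F + g)) / g ^+ 2).
  apply: (mulfI g0); apply/eqP; rewrite -subr_eq0; apply/eqP; rewrite -hbE.
  by field.
have : (F - 1) * (F + 1) = 0 by rewrite -subr_sqr F1 expr1n subrr.
move/eqP; rewrite mulf_eq0 subr_eq0 addr_eq0 => /orP[] /eqP ->.
  by apply/rowP => i; rewrite !mxE; field.
by apply/rowP => i; rewrite !mxE; field.
Qed.

Section Local.
Variables (s : R) (M : set (plane R)) (theta : R).
Variables (y ystar l lstar : plane R -> {vspace 'rV[R]_6}).
Hypotheses (t0 : theta != 0) (Dth : Dtheta_transform M theta y ystar).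
Hypotheses (cl : conjugate_lines M y) (pol : polar_map s M y l).
Hypotheses (pols : polar_map s M ystar lstar) (imms : immersion M lstar).

Lemma polar_transform_local V X p : open V -> V `<=` M -> canonical_lift V l X -> V p ->
  exists W (Xs : plane R -> 'rV[R]_6) (n : bool -> plane R -> R),
  [/\ open W, W p & W `<=` V] /\
  [/\ smooth_on W Xs, line_pair W theta Xs X n & forall q, W q ->
      [/\ form42 (X q) (Xs q) = -1, light_cone (Xs q) & lstar q = qproj (Xs q)]].
Proof.
move=> oV VM cX Vp.
have cls := Dtheta_conjugate_lines t0 Dth pol cl.
have [W1 [Y [N [r [f [a [[oW1 W1p W1V] [[cY1 fr1 f1 sa1 pr1] XYf1]]]]]]]] :=
  polar_map_line_pair pol cl oV VM cX Vp.
have W1M := subset_trans W1V VM.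
have [Ys [m [lYs1 norm1 sm1 prs1]]] := Dtheta_pair Dth oW1 W1M cY1.
have [U2 [Z [N' [r' [X' [[oU2 U2p U2M] [cZ2 fr2 lE2]]]]]]] := pols (VM _ Vp).
have oW2 := openI oW1 oU2.
have W21 : W1 `&` U2 `<=` W1 by move=> q [].
have W22 : W1 `&` U2 `<=` U2 by move=> q [].
have pr2 : line_pair (W1 `&` U2) theta Ys Y m by move=> b q /W21; exact: prs1.
have [W [c [oW Wp WW2 ct ZE]]] := canonical_lift_multiple oW2 (canonical_lift_sub W21 cY1)
  (local_lift_sub W21 lYs1) (fun q h => norm1 q (W21 q h)) pr2 (canonical_lift_sub W22 cZ2)
  t0 (conj W1p U2p).
have WW1 := subset_trans WW2 W21; have WU2 := subset_trans WW2 W22.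
have cY := canonical_lift_sub WW1 cY1; have fr := polar_frame_sub WW1 fr1.
have lYs := local_lift_sub WW1 lYs1; have cZ := canonical_lift_sub WU2 cZ2.
have frs := polar_frame_sub WU2 fr2.
have norm q : W q -> form42 (Y q) (Ys q) = -1 by move=> /WW1; exact: norm1.
have sa b : smooth_on W (a b) by exact: smooth_sub WW1 (sa1 b).
have sm b : smooth_on W (m b) by exact: smooth_sub WW1 (sm1 b).
have pr : line_pair W f X Y a by move=> b q /WW1; exact: pr1.
have prs : line_pair W theta Ys Y m by move=> b q /WW1; exact: prs1.
have XYf q : W q -> form42 (pu X q) (pu Y q) = f by move=> /WW1; exact: XYf1.
have WM := subset_trans WU2 U2M.
have uvY q : W q -> exists sigma : R, pu (pv Y) q = sigma *: Y q by exact: cl oW WM cY q.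
have [sr sX H] := fr; have [sr' sX' H'] := frs.
have sY := cY.1.1; have sYs := lYs.1.
pose g q := form42 (X q) (Ys q).
pose A q := adj (Y q) (Ys q) (- (f / theta)) (X q).
have X'E q : W q -> exists2 e, e != 0 & X' q = e *: A q.
  move=> Wq.
  have sgf : sg R false * theta = theta by rewrite /sg expr0 mul1r.
  have sgt : sg R true * theta = - theta by rewrite /sg expr1 mulN1r.
  have Eu := prs false q Wq; have Ev := prs true q Wq; rewrite sgf in Eu; rewrite sgt in Ev.
  have dzE : pu (pu Z) q + pv (pv Z) q = c *: (pu (pu Ys) q + pv (pv Ys) q).
    rewrite scalerDr; congr (_ + _).
      exact: (pd2_multiple false false oW sYs Wq ZE).
    exact: (pd2_multiple true true oW sYs Wq ZE).
  have ld := adj_normalized_laplace oW cY lYs norm t0 sm prs fr Wq.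
  have rd := adj_normalized_laplace oW cY lYs norm t0 sm prs (polar_frame_swap fr) Wq.
  rewrite (XYf _ Wq) in ld.
  exact: (transformed_polar (H q Wq) (H' q Wq) (ZE q Wq) (pd_multiple false oW sYs Wq ZE)
    (pd_multiple true oW sYs Wq ZE) dzE ct (norm q Wq) (local_lift_null lYs Wq)
    (normalized_lift_tangent oW cY lYs norm prs false Wq)
    (normalized_lift_tangent oW cY lYs norm prs true Wq) Eu Ev ld rd).
have g0 q : W q -> g q != 0.
  move=> Wq; have [e e0 E] := X'E q Wq.
  have lX' : local_lift W lstar X'.
    split=> // q' Wq'; split; last by rewrite lE2 //; exact: WU2.
      move=> X'0; have := pb_rl (H' q' Wq'); rewrite X'0 form420r => /eqP.
      by rewrite eq_sym oppr_eq0 oner_eq0.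
    exact: pb_ll (H' q' Wq').
  (* The nonzero product <X'_u, Z_u> equals - <X', Z_uu>, a multiple of <A, Ys_uu>, which would
     vanish with g. *)
  have := polar_nondegenerate cls imms oW WM lX' cZ frs Wq; apply: contra_neq => gq0.
  have E1 := polar_second_diag oW cZ frs false Wq.
  rewrite [pd false _ q](pd2_multiple false false oW sYs Wq ZE) E in E1.
  have := adj_normalized_second oW cY lYs norm t0 sm prs fr false Wq.
  rewrite (XYf _ Wq) -/(A q) -/(g q) gq0 mulr0 oppr0 => E2.
  move: E1; rewrite form42Zl form42Zr E2 !mulr0 => /eqP.
  by rewrite eq_sym oppr_eq0 mulf_eq0 /sg signr_eq0 => /eqP.
have sg' : smooth_on W g by exact: smooth_form oW sX sYs.
pose B q := (f * theta) *: X q + (-1) *: Ys q.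
have sB : smooth_on W B by exact: smoothD oW (smoothZ _ oW sX) (smoothZ _ oW sYs).
have sh : smooth_on W (fun q => (g q)^-1) by exact: smoothV oW g0 sg'.
(* The multiple of [A] having product -1 with [X]: <X, A> = - f g / theta, so by f^2 = 1 the factor
   is f theta / g. *)
pose Xs q := (g q)^-1 *: B q + (f * theta) *: Y q.
have f0 : f != 0 by apply/eqP => f0; move: f1; rewrite f0 expr0n => /eqP; rewrite eq_sym oner_eq0.
have XsA q : W q -> Xs q = (f * theta / g q) *: A q.
  move=> Wq; have gq0 := g0 q Wq; rewrite /Xs /A /adj -/(g q) /B.
  have ff : f^-1 = f by apply: (mulfI f0); rewrite divff // -expr2.
  move: (g q) gq0 (X q) (Ys q) (Y q) => k k0 x ys y0.
  apply/rowP => i; rewrite !mxE.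
  transitivity (k^-1 * (f * theta * x 0 i - f ^+ 2 * ys 0 i) + f * theta * y0 0 i).
    by rewrite f1; ring.
  by field; rewrite ?k0 ?t0.
(* This coefficient is <X_b, Xs>, the value forced by differentiating <X, Xs> = -1. *)
exists W, Xs, (fun b q => (a b q * (sg R b * f - g q) - m b q * (sg R b * f)) / g q).
split; first by split=> //; exact: subset_trans WW1 W1V.
have sXs : smooth_on W Xs.
  by apply: (smoothD oW); [exact: smooth_scale | exact: smoothZ].
split; first exact: sXs.
- move=> b q Wq; have gq0 := g0 q Wq.
  have XbE := pr b q Wq; have YsbE := prs b q Wq.
  have gb : pd b g q = a b q * (g q - sg R b * f) + m b q * (sg R b * f + g q).
    rewrite (pd_form b sX sYs Wq) XbE YsbE.
    have XY := pb_lx (H q Wq).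
    have Xt : form42 (X q) (pd b Y q) = 0 by exact: (polar_tangent fr b Wq).
    have mE := normalized_lift_tangent oW cY lYs norm prs b Wq; have yys := norm q Wq.
    rewrite /g; move: (pd b Y q) (X q) (Y q) (Ys q) (m b q) XY Xt mE yys => yb x y0 ys k.
    move=> XY Xt mE yys.
    rewrite !form42Dl !form42Zl !form42Dl !form42Zl !form42Dr !form42Zr !form42Dr !form42Zr.
    by rewrite XY Xt mE yys; ring.
  have hb : pd b g q * (g q)^-1 + g q * pd b (fun q => (g q)^-1) q = 0.
    have gV q' : W q' -> g q' * (g q')^-1 = 1 by move=> Wq'; rewrite divff // g0.
    have := pd_cst b oW Wq gV.
    by rewrite (pdM b sg' sh Wq) addrC (mulrC (pd b g q)).
  rewrite gb in hb.
  rewrite (pdD b (smooth_scale oW sh sB) (smoothZ _ oW sY) Wq) (pd_scale b sh sB Wq).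
  rewrite (pdZ b _ sY Wq) (pdD b (smoothZ _ oW sX) (smoothZ _ oW sYs) Wq).
  rewrite (pdZ b _ sX Wq) (pdZ b _ sYs Wq).
  have F1 : (sg R b * f) ^+ 2 = 1 by rewrite exprMn f1 mulr1 /sg sqrr_sign.
  have Ft : f * theta = sg R b * f * (sg R b * theta).
    by rewrite mulrACA sg_sqr mul1r.
  rewrite /Xs /B Ft; exact: line_pair_transform_alg F1 gq0 XbE YsbE hb.
- move=> q Wq; have gq0 := g0 q Wq; have [e e0 X'q] := X'E q Wq.
  have k0 : f * theta / g q != 0 by rewrite !mulf_neq0 // invr_eq0.
  split.
  + rewrite form42Dr !form42Zr form42Dr !form42Zr (pb_ll (H q Wq)) (pb_lx (H q Wq)) -/(g q).
    by rewrite !mulr0 addr0 add0r mulN1r mulrN mulVf.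
  + rewrite /light_cone /= XsA // form42Zl form42Zr.
    have : form42 (X' q) (X' q) = 0 by exact: pb_ll (H' q Wq).
    rewrite X'q form42Zl form42Zr => /eqP; rewrite !mulf_eq0 (negbTE e0) /= => /eqP ->.
    by rewrite !mulr0.
  + by rewrite XsA // qprojZ // lE2 ?X'q ?qprojZ //; exact: WU2.
Qed.
End Local.
End PolarTransform.

(** * From local lifts to the transform of the polar surface *)

Section Assembly.
Local Open Scope complex_scope.
Variables (R : realType) (s : R) (M : set (plane R)) (theta : R).
Variables (y ystar l lstar : plane R -> {vspace 'rV[R]_6}).
Hypotheses (t0 : theta != 0) (Dth : Dtheta_transform M theta y ystar).
Hypotheses (cl : conjugate_lines M y) (pol : polar_map s M y l).
Hypotheses (pols : polar_map s M ystar lstar).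
Hypotheses (imm : immersion M l) (imms : immersion M lstar).

Let cls : conjugate_lines M ystar := Dtheta_conjugate_lines t0 Dth pol cl.

(** The normalization singles out one vector of the line, so any generator rescales to it. The
    normalized lift thus has one formula on the whole domain, with no choice of frame. *)
Lemma normalized_vpick (w x : 'rV[R]_6) : form42 x w = -1 ->
  - (form42 x (vpick (qproj w)))^-1 *: vpick (qproj w) = w.
Proof.
move=> xw; have /vlineP[k E] := memv_pick (qproj w).
have k0 : k != 0.
  apply/eqP => k0; have : vpick (qproj w) == 0 by rewrite E k0 scale0r.
  rewrite vpick0 -subv0 => /subvP/(_ w (memv_line w)); rewrite memv0 => /eqP w0.
  by move: xw; rewrite w0 form420r => /eqP; rewrite eq_sym oppr_eq0 oner_eq0.
by rewrite E form42Zr xw mulrN1 invrN opprK scalerA mulVf // scale1r.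
Qed.

Lemma polar_transform_lift V (X : plane R -> 'rV[R]_6) :
  open V -> V `<=` M -> canonical_lift V l X -> exists Xs n,
  [/\ local_lift V lstar Xs, forall p, V p -> form42 (X p) (Xs p) = -1,
      forall b, smooth_on V (n b) & line_pair V theta Xs X n].
Proof.
move=> oV VM cX.
pose Xs p := - (form42 (X p) (vpick (lstar p)))^-1 *: vpick (lstar p).
have loc p : V p -> exists W (Xl : plane R -> 'rV[R]_6) (n : bool -> plane R -> R),
    [/\ open W, W p & W `<=` V] /\
    [/\ smooth_on W Xl, line_pair W theta Xl X n & forall q, W q ->
      [/\ form42 (X q) (Xl q) = -1, light_cone (Xl q), lstar q = qproj (Xl q)
        & Xs q = Xl q]].
  move=> Vp; have [W [Xl [n [[oW Wp WV] [sXl pr H]]]]] :=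
    polar_transform_local t0 Dth cl pol pols imms oV VM cX Vp.
  exists W, Xl, n; split; first by split.
  split=> // q Wq; have [h1 h2 h3] := H q Wq; split=> //.
  by rewrite /Xs h3 normalized_vpick.
have sXs : smooth_on V Xs.
  apply: smooth_locally => p /loc[W [Xl [n [[oW Wp _] [sXl _ H]]]]].
  by exists W, Xl; split=> // q /H[].
have sX := cX.1.1.
(* Pairing the local equation with [X], which is orthogonal to itself and to X_b, gives this
   expression for the coefficient; it no longer depends on the neighbourhood and is smooth on all of
   [V]. *)
exists Xs, (fun b q => - form42 (pd b Xs q) (X q)); split.
- split=> // p /loc[W [Xl [n [[_ Wp _] [_ _ H]]]]].
  have [h1 h2 h3 h4] := H p Wp; rewrite h4 h3; split=> //.
  by move=> Xl0; move: h1; rewrite Xl0 form420r => /eqP; rewrite eq_sym oppr_eq0 oner_eq0.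
- by move=> p /loc[W [Xl [n [[_ Wp _] [_ _ H]]]]]; have [h1 _ _ ->] := H p Wp.
- by move=> b; apply: (smoothN oV); exact: smooth_form oV (smooth_pd b sXs) sX.
move=> b p Vp; have [W [Xl [n [[oW Wp _] [_ pr H]]]]] := loc p Vp.
have XsE q : W q -> Xs q = Xl q by case/H.
have [h1 _ _ _] := H p Wp.
have D : pd b Xs p = n b p *: (Xs p + (sg R b * theta) *: X p) + (sg R b * theta) *: pd b X p.
  by rewrite (pd_eq b oW Wp XsE) (XsE p Wp); exact: pr.
suff nE : n b p = - form42 (pd b Xs p) (X p) by rewrite -nE.
have XX := local_lift_null cX.1 Vp; have Xt := local_lift_tangent b oV cX.1 Vp.
rewrite -(XsE p Wp) in h1.
rewrite D; move: (pd b X p) (X p) (Xs p) h1 XX Xt => xb x xs h1 XX Xt.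
rewrite form42Dl !form42Zl form42Dl form42Zl (form42C xs) h1 XX (form42C xb) Xt; ring.
Qed.

(** An arbitrary lift is c times the normalized one, and [cu], [cv] are the derivatives of c. With
    mu = nu - i nv the three coefficients are c_z / c + mu / 2, c t conj(mu) / 2 and c t. *)
Lemma darboux_vec (c nu nv t cu cv : R) (xs x : 'rV[R]_6) (xsu xsv xu xv : 'rV[R]_6)
    (z zb : 'rV[R[i]]_6) : c != 0 ->
  xsu = nu *: (xs + t *: x) + t *: xu -> xsv = nv *: (xs + (- t) *: x) + (- t) *: xv ->
  reV z = 2^-1 *: (cu *: xs + c *: xsu) -> imV z = - 2^-1 *: (cv *: xs + c *: xsv) ->
  reV zb = 2^-1 *: xu -> imV zb = 2^-1 *: xv ->
  z \in <<[:: cplx (c *: xs); cplx x; zb]>>%VS.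
Proof.
move=> c0 -> -> zr zi zbr zbi.
have -> : z = ((2^-1 * (cu / c + nu)) +i* (- 2^-1 * (cv / c + nv)))%C *: cplx (c *: xs) +
    ((2^-1 * c * nu * t) +i* (2^-1 * c * nv * t))%C *: cplx x + (c * t)%:C *: zb.
  apply: cvec_eq.
    rewrite zr !reVD !reVZ !reV_cplx !imV_cplx zbr zbi.
    by apply/rowP => i; rewrite !mxE /=; field.
  rewrite zi !imVD !imVZ !reV_cplx !imV_cplx zbr zbi.
  by apply/rowP => i; rewrite !mxE /=; field.
by rewrite !memvD // memvZ // memv_span // !inE eqxx ?orbT.
Qed.

Lemma polar_transform : Dtheta_transform M theta l lstar.
Proof.
split.
  split.
  - exact: polar_map_isothermic pol cl imm.
  - exact: polar_map_spacelike pols cls imms.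
  move=> V X Ls oV VM cX lLs p Vp.
  have [Xs [n [lXs norm sn pr]]] := polar_transform_lift oV VM cX.
  have sX := cX.1.1.
  pose c q := - form42 (X q) (Ls q).
  have sc : smooth_on V c by apply: (smoothN oV); exact: smooth_form oV sX lLs.1.
  have LE q : V q -> c q != 0 /\ Ls q = c q *: Xs q.
    move=> Vq; have [_ /(_ q Vq)[L0 _ Ll]] := lLs; have [_ /(_ q Vq)[_ _ Xl]] := lXs.
    have [k k0 E] : exists2 k, k != 0 & Ls q = k *: Xs q by apply: qproj_eqP; rewrite // Ll Xl.
    by rewrite /c E form42Zr (norm q Vq) mulrN1 opprK.
  have [c0 LpE] := LE p Vp.
  have dL b : pd b Ls p = pd b c p *: Xs p + c p *: pd b Xs p.
    rewrite (pd_eq b oV Vp (fun q Vq => (LE q Vq).2)); exact: pd_scale sc lXs.1 Vp.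
  have Eu := pr false p Vp; have Ev := pr true p Vp.
  have sgf : sg R false * theta = theta by rewrite /sg expr0 mul1r.
  have sgt : sg R true * theta = - theta by rewrite /sg expr1 mulN1r.
  rewrite sgf in Eu; rewrite sgt in Ev.
  have dLu : pu Ls p = _ := dL false; have dLv : pv Ls p = _ := dL true.
  have zr := reV_Yz Ls p; have zi := imV_Yz Ls p; rewrite dLu in zr; rewrite dLv in zi.
  rewrite LpE.
  exact: (darboux_vec c0 Eu Ev zr zi (reV_Yzb X p) (imV_Yzb X p)).
move=> V X oV VM cX.
have [Xs [n [lXs norm sn pr]]] := polar_transform_lift oV VM cX.
exists Xs; split=> //.
exists (fun p => (n false p -i* n true p)%C); split.
  by split; [exact: sn | apply: (smoothN oV); exact: sn].
move=> p Vp; have Eu := pr false p Vp; have Ev := pr true p Vp.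
apply/(pair_equation_parts _ theta (Xs p) (X p) (reV_Yz Xs p) (imV_Yz Xs p)
  (reV_Yzb X p) (imV_Yzb X p)).
have sgf : sg R false * theta = theta by rewrite /sg expr0 mul1r.
have sgt : sg R true * theta = - theta by rewrite /sg expr1 mulN1r.
rewrite sgf in Eu; rewrite sgt !scaleNr in Ev; split; first exact: Eu.
by rewrite /= opprK; exact: Ev.
Qed.
End Assembly.

Theorem theorem7p1 (R : realType) (M : set (R * R)%type)
    (y ystar : R * R -> {vspace 'rV[R]_6}) (theta : R)
    (openM : open M) (iso_y : isothermic M y) (theta_neq0 : theta <> 0)
    (Dth : Dtheta_transform M theta y ystar) :
  (forall l lstar : R * R -> {vspace 'rV[R]_6},
     left_polar M y l -> left_polar M ystar lstar ->
     nondegenerate_polar M l -> nondegenerate_polar M lstar ->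
     Dtheta_transform M theta l lstar) /\
  (forall r rstar : R * R -> {vspace 'rV[R]_6},
     right_polar M y r -> right_polar M ystar rstar ->
     nondegenerate_polar M r -> nondegenerate_polar M rstar ->
     Dtheta_transform M theta r rstar).
Proof.
have t0 : theta != 0 by apply/eqP.
have cl := isothermic_conjugate_lines iso_y.
split=> l lstar pl pls imm imms.
  exact: polar_transform t0 Dth cl (left_polar_map pl) (left_polar_map pls) imm imms.
exact: polar_transform t0 Dth cl (right_polar_map pl) (right_polar_map pls) imm imms.
Qed.
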